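(* Let $(X,\mathcal O_X)$ be a quasi-compact excellent scheme. Then, for the function $$C\colon X\longrightarrow\mathbb N,\qquad x\longmapsto \operatorname{edim}(\mathcal O_{X,x})-\dim(\mathcal O_{X,x})$$ on $X$, the subset $C^{-1}(\mathbb N_{\leq n})=\{x\in X\mid C(x)\leq n\}$ is constructible in $X$ for every $n\in\mathbb N$.
   Context: $\mathbb N=\{0,1,2,\ldots\}$ and $\mathbb N_{\le n}=\{k\in\mathbb N\mid k\le n\}$. For a Noetherian local ring $(A,\mathfrak m,k)$, $\operatorname{edim}(A)=\dim_k(\mathfrak m/\mathfrak m^2)$ is its embedding dimension. An excellent scheme is a locally Noetherian scheme which admits an open covering by spectra of excellent rings. *)

(* Defs.v *)
From HB Require Import structures.
From mathcomp Require Import all_boot all_order all_algebra ring.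
From mathcomp Require Import boolp classical_sets topology.

Set Implicit Arguments.
Unset Strict Implicit.
Unset Printing Implicit Defensive.

Import GRing.Theory.

Local Open Scope classical_set_scope.
Local Open Scope ring_scope.

(** Rings are commutative with 1 and possibly trivial ([comPzRingType]): the
    zero ring occurs, e.g. as the ring of sections over the empty set.  The
    ideals of [ring_quotient] require nontrivial rings, hence the
    redefinitions below. *)

(** Representatives of the elements of a ring, with the ring axioms holding up
    to [pr_eqv]. *)
Record preComRing := PreComRing {
  pr_car :> Type;
  pr_eqv : pr_car -> pr_car -> Prop;
  pr_zero : pr_car;
  pr_one : pr_car;
  pr_add : pr_car -> pr_car -> pr_car;
  pr_opp : pr_car -> pr_car;
  pr_mul : pr_car -> pr_car -> pr_car;
  pr_refl : forall x, pr_eqv x x;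
  pr_sym : forall x y, pr_eqv x y -> pr_eqv y x;
  pr_trans : forall x y z, pr_eqv x y -> pr_eqv y z -> pr_eqv x z;
  pr_add_eqv : forall x x' y y', pr_eqv x x' -> pr_eqv y y' ->
    pr_eqv (pr_add x y) (pr_add x' y');
  pr_opp_eqv : forall x x', pr_eqv x x' -> pr_eqv (pr_opp x) (pr_opp x');
  pr_mul_eqv : forall x x' y y', pr_eqv x x' -> pr_eqv y y' ->
    pr_eqv (pr_mul x y) (pr_mul x' y');
  pr_addA : forall x y z,
    pr_eqv (pr_add x (pr_add y z)) (pr_add (pr_add x y) z);
  pr_addC : forall x y, pr_eqv (pr_add x y) (pr_add y x);
  pr_add0 : forall x, pr_eqv (pr_add pr_zero x) x;
  pr_addN : forall x, pr_eqv (pr_add (pr_opp x) x) pr_zero;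
  pr_mulA : forall x y z,
    pr_eqv (pr_mul x (pr_mul y z)) (pr_mul (pr_mul x y) z);
  pr_mulC : forall x y, pr_eqv (pr_mul x y) (pr_mul y x);
  pr_mul1 : forall x, pr_eqv (pr_mul pr_one x) x;
  pr_mulDl : forall x y z, pr_eqv (pr_mul (pr_add x y) z)
    (pr_add (pr_mul x z) (pr_mul y z))
}.

Record ring_quot (P : preComRing) := RingQuot {
  qset : set P;
  qsetP : exists x, qset = [set y | pr_eqv x y]
}.

Definition qcls (P : preComRing) (x : P) : ring_quot P :=
  RingQuot (ex_intro _ x erefl).

Definition qrepr (P : preComRing) (c : ring_quot P) : P :=
  projT1 (cid (qsetP c)).

Section QuotTheory.
Variable P : preComRing.

Lemma qset_inj : injective (@qset P).
Proof.
by move=> [C hC] [D hD] /= CD; subst D; congr RingQuot; exact: Prop_irrelevance.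
Qed.

Lemma qclsP (x y : P) : qcls x = qcls y <-> pr_eqv x y.
Proof.
split=> [/(congr1 (@qset P))/= E|xy].
  by rewrite -[pr_eqv x y]/([set z | pr_eqv x z] y) E; exact: pr_refl.
apply: qset_inj; apply/seteqP; split=> z /= h.
- exact: pr_trans (pr_sym xy) h.
- exact: pr_trans xy h.
Qed.

Lemma qreprK (c : ring_quot P) : qcls (qrepr c) = c.
Proof. by apply: qset_inj; rewrite /qrepr; case: (cid _) => x /= ->. Qed.

Lemma qrepr_eqv (x : P) : pr_eqv (qrepr (qcls x)) x.
Proof. by apply/qclsP; rewrite qreprK. Qed.

HB.instance Definition _ := gen_eqMixin (ring_quot P).
HB.instance Definition _ := gen_choiceMixin (ring_quot P).

Definition qadd (c d : ring_quot P) := qcls (pr_add (qrepr c) (qrepr d)).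
Definition qopp (c : ring_quot P) := qcls (pr_opp (qrepr c)).
Definition qmul (c d : ring_quot P) := qcls (pr_mul (qrepr c) (qrepr d)).

Lemma qaddE (x y : P) : qadd (qcls x) (qcls y) = qcls (pr_add x y).
Proof. by apply/qclsP/pr_add_eqv; exact: qrepr_eqv. Qed.

Lemma qoppE (x : P) : qopp (qcls x) = qcls (pr_opp x).
Proof. by apply/qclsP/pr_opp_eqv; exact: qrepr_eqv. Qed.

Lemma qmulE (x y : P) : qmul (qcls x) (qcls y) = qcls (pr_mul x y).
Proof. by apply/qclsP/pr_mul_eqv; exact: qrepr_eqv. Qed.

Lemma qaddA : associative qadd.
Proof.
move=> a b c; rewrite -(qreprK a) -(qreprK b) -(qreprK c) !qaddE.
exact/qclsP/pr_addA.
Qed.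

Lemma qaddC : commutative qadd.
Proof.
by move=> a b; rewrite -(qreprK a) -(qreprK b) !qaddE; exact/qclsP/pr_addC.
Qed.

Lemma qadd0 : left_id (qcls (pr_zero P)) qadd.
Proof. by move=> a; rewrite -(qreprK a) qaddE; exact/qclsP/pr_add0. Qed.

Lemma qaddN : left_inverse (qcls (pr_zero P)) qopp qadd.
Proof. by move=> a; rewrite -(qreprK a) qoppE qaddE; exact/qclsP/pr_addN. Qed.

HB.instance Definition _ :=
  GRing.isZmodule.Build (ring_quot P) qaddA qaddC qadd0 qaddN.

Lemma qmulA : associative qmul.
Proof.
move=> a b c; rewrite -(qreprK a) -(qreprK b) -(qreprK c) !qmulE.
exact/qclsP/pr_mulA.
Qed.

Lemma qmulC : commutative qmul.
Proof.
by move=> a b; rewrite -(qreprK a) -(qreprK b) !qmulE; exact/qclsP/pr_mulC.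
Qed.

Lemma qmul1 : left_id (qcls (pr_one P)) qmul.
Proof. by move=> a; rewrite -(qreprK a) qmulE; exact/qclsP/pr_mul1. Qed.

Lemma qmulDl : left_distributive qmul qadd.
Proof.
move=> a b c; rewrite -(qreprK a) -(qreprK b) -(qreprK c).
by rewrite !(qmulE, qaddE); exact/qclsP/pr_mulDl.
Qed.

HB.instance Definition _ :=
  GRing.Zmodule_isComPzRing.Build (ring_quot P) qmulA qmulC qmul1 qmulDl.

Lemma qcls0 : qcls (pr_zero P) = 0. Proof. by []. Qed.
Lemma qcls1 : qcls (pr_one P) = 1. Proof. by []. Qed.
Lemma qclsD (x y : P) : qcls (pr_add x y) = qcls x + qcls y.
Proof. by rewrite -qaddE. Qed.
Lemma qclsN (x : P) : qcls (pr_opp x) = - qcls x.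
Proof. by rewrite -qoppE. Qed.
Lemma qclsM (x y : P) : qcls (pr_mul x y) = qcls x * qcls y.
Proof. by rewrite -qmulE. Qed.

End QuotTheory.

Section Ideals.
Variable A : comPzRingType.
Implicit Types (I p E : set A).

Definition is_ideal I :=
  [/\ I 0, forall a b, I a -> I b -> I (a + b) & forall a b, I b -> I (a * b)].

Definition ideal_gen E : set A := smallest is_ideal E.

Fixpoint idealX I (n : nat) : set A :=
  if n is m.+1 then
    ideal_gen [set z | exists x y, [/\ idealX I m x, I y & z = x * y]]
  else [set: A].

Definition is_prime p :=
  [/\ is_ideal p, ~ p 1 & forall a b, p (a * b) -> p a \/ p b].

Definition is_maximal p :=
  [/\ is_ideal p, ~ p 1 &
      forall I, is_ideal I -> ~ I 1 -> p `<=` I -> I = p].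

Definition noetherian :=
  forall I, is_ideal I -> exists s : seq A, I = ideal_gen [set` s].

Definition local_ring := exists! m, is_maximal m.

(** In a local ring, [nonunits] is the maximal ideal. *)
Definition nonunits : set A := [set a | ~ exists b, a * b = 1].

Definition multiplicative (S : set A) :=
  S 1 /\ forall a b, S a -> S b -> S (a * b).

End Ideals.

Arguments noetherian : clear implicits.
Arguments local_ring : clear implicits.
Arguments nonunits : clear implicits.

Section IdealTheory.
Variable A : comPzRingType.

Lemma is_idealN (I : set A) a : is_ideal I -> I a -> I (- a).
Proof. by case=> _ _ IM Ia; rewrite -mulN1r; exact: IM. Qed.

Lemma is_idealL (I : set A) a b c d :
  is_ideal I -> I a -> I b -> I (c * a + d * b).
Proof. by case=> _ ID IM Ia Ib; apply: ID; exact: IM. Qed.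

Lemma is_ideal_gen (E : set A) : is_ideal (ideal_gen E).
Proof.
split=> [I [[]]//|a b ha hb I IE|a b hb I IE].
- by case: (IE) => -[_ ID _] _; apply: ID; [exact: ha|exact: hb].
- by case: (IE) => -[_ _ IM] _; apply: IM; exact: hb.
Qed.

Lemma is_idealX (I : set A) n : is_ideal (idealX I n).
Proof. by case: n => [|n]; [split|exact: is_ideal_gen]. Qed.

Lemma is_ideal0 : is_ideal [set (0 : A)].
Proof.
by split=> //= a b; [move=> -> ->; rewrite addr0|move=> ->; rewrite mulr0].
Qed.

End IdealTheory.

Record Spec (A : comPzRingType) := MkSpec {
  prime_set :> set A;
  prime_setP : is_prime prime_set
}.

HB.instance Definition _ (A : comPzRingType) := gen_eqMixin (Spec A).
HB.instance Definition _ (A : comPzRingType) := gen_choiceMixin (Spec A).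

Section Zariski.
Variable A : comPzRingType.

Definition zariski_open : set_system (Spec A) :=
  [set U | exists E : set A, U = ~` [set p : Spec A | E `<=` p]].

Lemma zariski_openT : zariski_open [set: Spec A].
Proof.
exists [set 1]; apply/seteqP; split=> // p _ /= h.
by case: (prime_setP p) => _ + _; apply; exact: h.
Qed.

Lemma zariski_openI : setI_closed zariski_open.
Proof.
move=> _ _ [E ->] [F ->].
exists [set z | exists x y, [/\ E x, F y & z = x * y]].
apply/seteqP; split=> p /=.
  move=> [nE nF] h.
  have [x /not_implyP[Ex px]] := (existsNP _).2 nE.
  have [y /not_implyP[Fy py]] := (existsNP _).2 nF.
  case: (prime_setP p) => _ _ /(_ x y) [|//|//].
  by apply: h; exists x, y.
move=> h; case: (prime_setP p) => -[_ _ pM] _ _.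
split=> k; apply: h => _ [x [y [Ex Fy ->]]].
- by rewrite mulrC; apply: pM; exact: k.
- by apply: pM; exact: k.
Qed.

Lemma zariski_open_bigU (I : Type) (f : I -> set (Spec A)) :
  (forall i, zariski_open (f i)) -> zariski_open (\bigcup_i f i).
Proof.
move=> fO; exists [set a | exists i (E : set A),
  f i = ~` [set p : Spec A | E `<=` p] /\ E a].
apply/seteqP; split=> p /=.
  move=> [i _]; have [E fE] := fO i; rewrite fE => + h; apply=> a Ea.
  by apply: h; exists i, E.
move=> /existsNP[a /not_implyP[[i [E [fE Ea]]] pa]].
by exists i => //; rewrite fE => h; exact/pa/h.
Qed.

HB.instance Definition _ := isOpenTopological.Build (Spec A)
  zariski_openT zariski_openI zariski_open_bigU.

End Zariski.

(** The ring of fractions S^-1 (A / I)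

    With I = 0 this is the localization S^-1 A; with I a prime ideal p and
    S = A \ p it is the fraction field of A / p. *)

Section Fractions.
Variables (A : comPzRingType) (I S : set A).
Hypotheses (idI : is_ideal I) (mS : multiplicative S).

Definition frac_rep := (A * {s : A | S s})%type.
Implicit Types x y z : frac_rep.

Definition frac_eqv x y :=
  exists2 u, S u & I (u * (x.1 * sval y.2 - y.1 * sval x.2)).

Definition fden1 : {s : A | S s} := exist _ 1 mS.1.
Definition fdenM (s t : {s : A | S s}) : {s : A | S s} :=
  exist _ (sval s * sval t) (mS.2 _ _ (svalP s) (svalP t)).

Definition frac_add x y : frac_rep :=
  (x.1 * sval y.2 + y.1 * sval x.2, fdenM x.2 y.2).
Definition frac_opp x : frac_rep := (- x.1, x.2).
Definition frac_mul x y : frac_rep := (x.1 * y.1, fdenM x.2 y.2).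

Lemma frac_eqv_eq x y : x.1 * sval y.2 = y.1 * sval x.2 -> frac_eqv x y.
Proof.
by move=> e; exists 1; [exact: mS.1|rewrite e subrr mulr0; case: idI].
Qed.

Lemma frac_sym x y : frac_eqv x y -> frac_eqv y x.
Proof.
by move=> [u Su h]; exists u => //; rewrite -opprB mulrN; exact: is_idealN.
Qed.

Lemma frac_trans x y z : frac_eqv x y -> frac_eqv y z -> frac_eqv x z.
Proof.
move: x y z => [a [s Ss]] [b [t St]] [c [r Sr]] [u Su /= h] [v Sv /= k].
exists (u * v * t); first by apply: mS.2 => //; exact: mS.2.
rewrite /= (_ : _ * _ = v * r * (u * (a * t - b * s)) +
  u * s * (v * (b * r - c * t))); first exact: is_idealL.
by ring.
Qed.

Lemma frac_add_eqv x x' y y' : frac_eqv x x' -> frac_eqv y y' ->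
  frac_eqv (frac_add x y) (frac_add x' y').
Proof.
move: x x' y y' => [a [s ?]] [a' [s' ?]] [b [t ?]] [b' [t' ?]].
move=> [u Su /= h] [v Sv /= k]; exists (u * v); first exact: mS.2.
rewrite /= (_ : _ * _ = v * t * t' * (u * (a * s' - a' * s)) +
  u * s * s' * (v * (b * t' - b' * t))); first exact: is_idealL.
by ring.
Qed.

Lemma frac_opp_eqv x x' : frac_eqv x x' ->
  frac_eqv (frac_opp x) (frac_opp x').
Proof.
move=> [u Su h]; exists u => //=.
by rewrite !mulNr -opprD mulrN; exact: is_idealN.
Qed.

Lemma frac_mul_eqv x x' y y' : frac_eqv x x' -> frac_eqv y y' ->
  frac_eqv (frac_mul x y) (frac_mul x' y').
Proof.
move: x x' y y' => [a [s ?]] [a' [s' ?]] [b [t ?]] [b' [t' ?]].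
move=> [u Su /= h] [v Sv /= k]; exists (u * v); first exact: mS.2.
rewrite /= (_ : _ * _ = v * b * t' * (u * (a * s' - a' * s)) +
  u * a' * s * (v * (b * t' - b' * t))); first exact: is_idealL.
by ring.
Qed.

Definition frac_preRing : preComRing.
Proof.
refine (@PreComRing frac_rep frac_eqv (0, fden1) (1, fden1)
  frac_add frac_opp frac_mul
  _ frac_sym frac_trans frac_add_eqv frac_opp_eqv frac_mul_eqv
  _ _ _ _ _ _ _ _); abstract by move=> *; apply: frac_eqv_eq => /=; ring.
Defined.

Definition frac_ring : comPzRingType := ring_quot frac_preRing.

Definition mkfrac (a : A) (s : A) (Ss : S s) : frac_ring :=
  @qcls frac_preRing (a, exist _ s Ss).

Definition frac_map (a : A) : frac_ring := mkfrac a mS.1.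

Lemma frac_map_additive : zmod_morphism frac_map.
Proof.
move=> a b; rewrite -qclsN -qclsD; apply/qclsP/frac_eqv_eq => /=; by ring.
Qed.

Lemma frac_map_multiplicative : monoid_morphism frac_map.
Proof.
split=> // a b; rewrite -qclsM; apply/qclsP/frac_eqv_eq => /=; by ring.
Qed.

HB.instance Definition _ :=
  GRing.isZmodMorphism.Build A frac_ring frac_map frac_map_additive.
HB.instance Definition _ :=
  GRing.isMonoidMorphism.Build A frac_ring frac_map frac_map_multiplicative.

End Fractions.

Section AtPrime.
Variables (A : comPzRingType) (p : Spec A).

Lemma prime_compl_multiplicative : multiplicative (~` (p : set A)).
Proof.
by case: (prime_setP p) => _ p1 pM; split=> // a b pa pb /pM [].
Qed.

Lemma prime_is_ideal : is_ideal (p : set A).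
Proof. by case: (prime_setP p). Qed.

Definition localization : comPzRingType :=
  frac_ring (is_ideal0 A) prime_compl_multiplicative.
Definition loc_map : {rmorphism A -> localization} :=
  frac_map (is_ideal0 A) prime_compl_multiplicative.
Definition loc_frac (a s : A) (ps : ~ prime_set p s) : localization :=
  mkfrac (is_ideal0 A) prime_compl_multiplicative a ps.

(** kappa(p) = Frac (A / p) *)
Definition residue_field : comPzRingType :=
  frac_ring prime_is_ideal prime_compl_multiplicative.
Definition residue_map : {rmorphism A -> residue_field} :=
  frac_map prime_is_ideal prime_compl_multiplicative.

End AtPrime.

(** Completion: the inverse limit of the rings A / I^n, as sequences
    (s_n) with s_(n+1) = s_n mod I^n *)

Section Completion.
Variables (A : comPzRingType) (I : set A).

Definition coherent (s : nat -> A) := forall n, idealX I n (s n.+1 - s n).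
Definition coherent_seq := {s : nat -> A | coherent s}.
Implicit Types s t : coherent_seq.

Definition coh_eqv s t := forall n, idealX I n (sval s n - sval t n).

Lemma coherentC a : coherent (fun=> a).
Proof. by move=> n; rewrite subrr; case: (is_idealX I n). Qed.

Lemma coherentD s t : coherent (fun n => sval s n + sval t n).
Proof.
by move=> n; rewrite opprD addrACA; case: (is_idealX I n) => _ h _; apply: h;
  [exact: (svalP s)|exact: (svalP t)].
Qed.

Lemma coherentN s : coherent (fun n => - sval s n).
Proof.
move=> n; rewrite -opprD.
by apply: is_idealN; [exact: is_idealX|exact: (svalP s)].
Qed.

Lemma coherentM s t : coherent (fun n => sval s n * sval t n).
Proof.
move=> n; rewrite (_ : _ - _ =
  sval t n.+1 * (sval s n.+1 - sval s n) +
  sval s n * (sval t n.+1 - sval t n)); last by ring.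
by apply: is_idealL; [exact: is_idealX|exact: (svalP s)|exact: (svalP t)].
Qed.

Definition cohC a : coherent_seq := exist _ _ (coherentC a).
Definition cohD s t : coherent_seq := exist _ _ (coherentD s t).
Definition cohN s : coherent_seq := exist _ _ (coherentN s).
Definition cohM s t : coherent_seq := exist _ _ (coherentM s t).

Lemma coh_eqv_eq s t : sval s =1 sval t -> coh_eqv s t.
Proof. by move=> e n; rewrite e subrr; case: (is_idealX I n). Qed.

Lemma coh_sym s t : coh_eqv s t -> coh_eqv t s.
Proof. by move=> h n; rewrite -opprB; apply: is_idealN => //; exact: is_idealX. Qed.

Lemma coh_trans s t r : coh_eqv s t -> coh_eqv t r -> coh_eqv s r.
Proof.
move=> h k n; rewrite -(subrKA (sval t n)).
by case: (is_idealX I n) => _ D _; apply: D.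
Qed.

Lemma cohD_eqv s s' t t' :
  coh_eqv s s' -> coh_eqv t t' -> coh_eqv (cohD s t) (cohD s' t').
Proof.
by move=> h k n; rewrite /= opprD addrACA; case: (is_idealX I n) => _ D _; apply: D.
Qed.

Lemma cohN_eqv s s' : coh_eqv s s' -> coh_eqv (cohN s) (cohN s').
Proof. by move=> h n; rewrite /= -opprD; apply: is_idealN => //; exact: is_idealX. Qed.

Lemma cohM_eqv s s' t t' :
  coh_eqv s s' -> coh_eqv t t' -> coh_eqv (cohM s t) (cohM s' t').
Proof.
move=> h k n; rewrite /= (_ : _ - _ =
  sval t n * (sval s n - sval s' n) + sval s' n * (sval t n - sval t' n));
  last by ring.
by apply: is_idealL => //; exact: is_idealX.
Qed.

Definition completion_preRing : preComRing.
Proof.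
refine (@PreComRing coherent_seq coh_eqv (cohC 0) (cohC 1) cohD cohN cohM
  _ coh_sym coh_trans cohD_eqv cohN_eqv cohM_eqv _ _ _ _ _ _ _ _);
  abstract by move=> *; apply: coh_eqv_eq => n /=; ring.
Defined.

Definition completion : comPzRingType := ring_quot completion_preRing.

Definition completion_map (a : A) : completion :=
  @qcls completion_preRing (cohC a).

Lemma completion_map_additive : zmod_morphism completion_map.
Proof. by move=> a b; rewrite -qclsN -qclsD; exact/qclsP/coh_eqv_eq. Qed.

Lemma completion_map_multiplicative : monoid_morphism completion_map.
Proof. by split=> // a b; rewrite -qclsM; exact/qclsP/coh_eqv_eq. Qed.

HB.instance Definition _ := GRing.isZmodMorphism.Build A completion
  completion_map completion_map_additive.
HB.instance Definition _ := GRing.isMonoidMorphism.Build A completion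
  completion_map completion_map_multiplicative.

End Completion.

(** Tensor product B (x)_A C of two A-algebras, by generators and relations:
    [TensL b] is b (x) 1 and [TensR c] is 1 (x) c *)

Section Tensor.
Variables (A B C : comPzRingType).
Variables (f : {rmorphism A -> B}) (g : {rmorphism A -> C}).

Inductive tens_expr : Type :=
| TensL of B
| TensR of C
| TensAdd of tens_expr & tens_expr
| TensOpp of tens_expr
| TensMul of tens_expr & tens_expr.

Inductive tens_eqv : tens_expr -> tens_expr -> Prop :=
| tens_refl x : tens_eqv x x
| tens_sym x y : tens_eqv x y -> tens_eqv y x
| tens_trans x y z : tens_eqv x y -> tens_eqv y z -> tens_eqv x z
| tens_add_eqv x x' y y' : tens_eqv x x' -> tens_eqv y y' ->
    tens_eqv (TensAdd x y) (TensAdd x' y')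
| tens_opp_eqv x x' : tens_eqv x x' -> tens_eqv (TensOpp x) (TensOpp x')
| tens_mul_eqv x x' y y' : tens_eqv x x' -> tens_eqv y y' ->
    tens_eqv (TensMul x y) (TensMul x' y')
| tens_addA x y z :
    tens_eqv (TensAdd x (TensAdd y z)) (TensAdd (TensAdd x y) z)
| tens_addC x y : tens_eqv (TensAdd x y) (TensAdd y x)
| tens_add0 x : tens_eqv (TensAdd (TensL 0) x) x
| tens_addN x : tens_eqv (TensAdd (TensOpp x) x) (TensL 0)
| tens_mulA x y z :
    tens_eqv (TensMul x (TensMul y z)) (TensMul (TensMul x y) z)
| tens_mulC x y : tens_eqv (TensMul x y) (TensMul y x)
| tens_mul1 x : tens_eqv (TensMul (TensL 1) x) x
| tens_mulDl x y z : tens_eqv (TensMul (TensAdd x y) z)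
    (TensAdd (TensMul x z) (TensMul y z))
| tens_LD b b' : tens_eqv (TensL (b + b')) (TensAdd (TensL b) (TensL b'))
| tens_LM b b' : tens_eqv (TensL (b * b')) (TensMul (TensL b) (TensL b'))
| tens_RD c c' : tens_eqv (TensR (c + c')) (TensAdd (TensR c) (TensR c'))
| tens_RM c c' : tens_eqv (TensR (c * c')) (TensMul (TensR c) (TensR c'))
| tens_LR a : tens_eqv (TensL (f a)) (TensR (g a)).

Definition tensor_preRing : preComRing :=
  @PreComRing tens_expr tens_eqv (TensL 0) (TensL 1) TensAdd TensOpp TensMul
    tens_refl tens_sym tens_trans tens_add_eqv tens_opp_eqv tens_mul_eqv
    tens_addA tens_addC tens_add0 tens_addN tens_mulA tens_mulC tens_mul1
    tens_mulDl.

Definition tensor : comPzRingType := ring_quot tensor_preRing.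

Definition tensor_inr (c : C) : tensor := @qcls tensor_preRing (TensR c).

Lemma tensor_inr_additive : zmod_morphism tensor_inr.
Proof.
move=> a b; apply/eqP; rewrite eq_sym subr_eq; apply/eqP.
by rewrite -qclsD; apply/qclsP; rewrite -{1}(subrK b a); exact: tens_RD.
Qed.

Lemma tensor_inr_multiplicative : monoid_morphism tensor_inr.
Proof.
split; last by move=> a b; rewrite -qclsM; apply/qclsP; exact: tens_RM.
by apply/qclsP/tens_sym; have := tens_LR 1; rewrite !rmorph1.
Qed.

HB.instance Definition _ := GRing.isZmodMorphism.Build C tensor
  tensor_inr tensor_inr_additive.
HB.instance Definition _ := GRing.isMonoidMorphism.Build C tensor
  tensor_inr tensor_inr_multiplicative.

End Tensor.

Section Dimension.
Variable A : comPzRingType.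

Definition prime_chain (d : nat) (P : 'I_d.+1 -> Spec A) :=
  forall i j : 'I_d.+1, (i < j)%N -> (P i : set A) `<` (P j : set A).

Definition is_krull_dim (d : nat) :=
  (exists P : 'I_d.+1 -> Spec A, prime_chain P) /\
  forall e (P : 'I_e.+1 -> Spec A), prime_chain P -> (e <= d)%N.

(** Junk value 0 when the supremum of the lengths is not a natural number,
    which does not happen for Noetherian local rings. *)
Definition krull_dim : nat := xget 0%N is_krull_dim.

(** The classes of x_1, ..., x_n form a basis of m / m^2 over A / m, with
    scalars lifted to A. *)
Definition cotangent_basis (m : set A) (n : nat) (x : 'I_n -> A) :=
  [/\ forall i, m (x i),
      forall y, m y -> exists a : 'I_n -> A,
        idealX m 2 (y - \sum_(i < n) a i * x i) &
      forall a : 'I_n -> A,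
        idealX m 2 (\sum_(i < n) a i * x i) -> forall i, m (a i)].

Definition is_edim (n : nat) :=
  exists x : 'I_n -> A, cotangent_basis (nonunits A) x.

(** Only meaningful for Noetherian local rings (junk value 0 when m / m^2 is
    infinite dimensional). *)
Definition edim : nat := xget 0%N is_edim.

Definition regular_local :=
  [/\ local_ring A, noetherian A & edim = krull_dim].

Definition saturated_chain d (P : 'I_d.+1 -> Spec A) :=
  prime_chain P /\
  forall (i j : 'I_d.+1) (r : Spec A), j = i.+1 :> nat ->
    ~ ((P i : set A) `<` (r : set A) /\ (r : set A) `<` (P j : set A)).

(** The first clause makes all chains from p to q finite, so that saturated
    chains are exactly the maximal ones. *)
Definition catenary := forall p q : Spec A, (p : set A) `<=` q ->
  (exists N, forall d (P : 'I_d.+1 -> Spec A), prime_chain P ->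
     P ord0 = p -> P ord_max = q -> (d <= N)%N) /\
  (forall d e (P : 'I_d.+1 -> Spec A) (Q : 'I_e.+1 -> Spec A),
     saturated_chain P -> P ord0 = p -> P ord_max = q ->
     saturated_chain Q -> Q ord0 = p -> Q ord_max = q -> d = e).

End Dimension.

Arguments krull_dim : clear implicits.
Arguments edim : clear implicits.
Arguments regular_local : clear implicits.
Arguments catenary : clear implicits.

Definition regular_ring (A : comPzRingType) :=
  noetherian A /\ forall p : Spec A, regular_local (localization p).

Definition regular_locus (A : comPzRingType) : set (Spec A) :=
  [set p | regular_local (localization p)].

Definition finite_type (A B : comPzRingType) (f : {rmorphism A -> B}) :=
  exists s : seq B, forall S : {pred B}, GRing.subring_closed S ->
    (forall a, f a \in S) -> {subset s <= S} -> forall b, b \in S.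

Definition finite_hom (A B : comPzRingType) (f : {rmorphism A -> B}) :=
  exists s : seq B, forall b : B,
    exists c : nat -> A, b = \sum_(i < size s) f (c i) * s`_i.

(** For a field [k] and a [k]-algebra [B]: regularity of B (x)_k K for all
    finite extensions K of k (EGA IV 6.7.6); being Noetherian is part of
    [regular_ring]. *)
Definition geometrically_regular (k B : comPzRingType)
    (f : {rmorphism k -> B}) :=
  forall (K : fieldType) (g : {rmorphism k -> K}), finite_hom g ->
    regular_ring (tensor f g).

(** The fibre over q of the completion R -> R^ of a local ring R is the
    kappa(q)-algebra R^ (x)_R kappa(q). *)
Definition formal_fibre_map (R : comPzRingType) (q : Spec R) :
    {rmorphism residue_field q ->
      tensor (completion_map (nonunits R)) (residue_map q)} :=
  tensor_inr (completion_map (nonunits R)) (residue_map q).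

Definition G_ring (A : comPzRingType) := noetherian A /\
  forall (p : Spec A) (q : Spec (localization p)),
    geometrically_regular (formal_fibre_map q).

Definition J2_ring (A : comPzRingType) := noetherian A /\
  forall (B : comPzRingType) (f : {rmorphism A -> B}), finite_type f ->
    open (@regular_locus B).

Definition universally_catenary (A : comPzRingType) := noetherian A /\
  forall (B : comPzRingType) (f : {rmorphism A -> B}), finite_type f ->
    catenary B.

Definition excellent_ring (A : comPzRingType) :=
  [/\ noetherian A, G_ring A, J2_ring A & universally_catenary A].

Record opens (X : topologicalType) := MkOpens {
  opens_set :> set X;
  opensP : open opens_set
}.

Definition opensT (X : topologicalType) : opens X := MkOpens openT.
Definition opensI (X : topologicalType) (U V : opens X) : opens X :=
  MkOpens (openI (opensP U) (opensP V)).

Record presheaf (X : topologicalType) := Presheaf {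
  sections :> opens X -> comPzRingType;
  res : forall U V : opens X, V `<=` U -> {rmorphism sections U -> sections V};
  res_id : forall (U : opens X) (h : U `<=` U) s, res h s = s;
  res_comp : forall (U V W : opens X) (h : V `<=` U) (k : W `<=` V)
    (l : W `<=` U) s, res k (res h s) = res l s
}.

Arguments res {X p U V} h.

Definition is_sheaf (X : topologicalType) (F : presheaf X) :=
  forall (I : Type) (U : opens X) (V : I -> opens X)
    (VU : forall i, V i `<=` U), U `<=` \bigcup_i V i ->
  forall s : forall i, F (V i),
    (forall i j (W : opens X) (Wi : W `<=` V i) (Wj : W `<=` V j),
       res Wi (s i) = res Wj (s j)) ->
    exists! t : F U, forall i, res (VU i) t = s i.

Section Stalk.
Variables (X : topologicalType) (F : presheaf X) (x : X).

Record germ_rep := GermRep {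
  germ_dom : opens X;
  germ_mem : opens_set germ_dom x;
  germ_sec : F germ_dom
}.
Implicit Types s t : germ_rep.

Definition germ_eqv s t := exists (W : opens X)
  (Ws : W `<=` germ_dom s) (Wt : W `<=` germ_dom t),
  opens_set W x /\ res Ws (germ_sec s) = res Wt (germ_sec t).

Definition germC (c : F (opensT X)) : germ_rep :=
  @GermRep (opensT X) I c.
Definition germ_opp s : germ_rep := GermRep (germ_mem s) (- germ_sec s).

Section Binary.
Variable op : forall U, F U -> F U -> F U.
Arguments op {U}.
Hypothesis opM : forall (U V : opens X) (h : V `<=` U) (a b : F U),
  res h (op a b) = op (res h a) (res h b).

Definition germ_op s t : germ_rep :=
  @GermRep (opensI (germ_dom s) (germ_dom t)) (conj (germ_mem s) (germ_mem t))
    (op (res (V := opensI _ _) (@subIsetl _ _ _) (germ_sec s))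
        (res (V := opensI _ _) (@subIsetr _ _ _) (germ_sec t))).

Lemma germ_op_eqv s s' t t' :
  germ_eqv s s' -> germ_eqv t t' -> germ_eqv (germ_op s t) (germ_op s' t').
Proof.
move=> [W [Ws [Ws' [Wx e]]]] [Z [Zt [Zt' [Zx k]]]].
have WZW : opensI W Z `<=` W by exact: subIsetl.
have WZZ : opensI W Z `<=` Z by exact: subIsetr.
have h1 : opensI W Z `<=` germ_dom (germ_op s t).
  by move=> y [Wy Zy]; split; [exact: (Ws y)|exact: (Zt y)].
have h2 : opensI W Z `<=` germ_dom (germ_op s' t').
  by move=> y [Wy Zy]; split; [exact: (Ws' y)|exact: (Zt' y)].
exists (opensI W Z), h1, h2; split=> //=; rewrite !opM.
have ls : opensI W Z `<=` germ_dom s by exact: subset_trans WZW Ws.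
have lt : opensI W Z `<=` germ_dom t by exact: subset_trans WZZ Zt.
have ls' : opensI W Z `<=` germ_dom s' by exact: subset_trans WZW Ws'.
have lt' : opensI W Z `<=` germ_dom t' by exact: subset_trans WZZ Zt'.
rewrite (res_comp _ _ ls) (res_comp _ _ lt) (res_comp _ _ ls').
rewrite (res_comp _ _ lt') -(res_comp Ws WZW) e (res_comp _ _ ls').
by rewrite -(res_comp Zt WZZ) k (res_comp _ _ lt').
Qed.

End Binary.

Definition germ_add := germ_op (fun U (a b : F U) => a + b).
Definition germ_mul := germ_op (fun U (a b : F U) => a * b).

Lemma germ_refl s : germ_eqv s s.
Proof.
have h : germ_dom s `<=` germ_dom s by [].
by exists (germ_dom s), h, h; split=> //; exact: germ_mem.
Qed.

Lemma germ_sym s t : germ_eqv s t -> germ_eqv t s.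
Proof. by move=> [W [Ws [Wt [Wx e]]]]; exists W, Wt, Ws. Qed.

Lemma germ_trans s t r : germ_eqv s t -> germ_eqv t r -> germ_eqv s r.
Proof.
move=> [W [Ws [Wt [Wx e]]]] [Z [Zt [Zr [Zx k]]]].
have WZW : opensI W Z `<=` W by exact: subIsetl.
have WZZ : opensI W Z `<=` Z by exact: subIsetr.
have ls : opensI W Z `<=` germ_dom s by exact: subset_trans WZW Ws.
have lt : opensI W Z `<=` germ_dom t by exact: subset_trans WZW Wt.
have lr : opensI W Z `<=` germ_dom r by exact: subset_trans WZZ Zr.
exists (opensI W Z), ls, lr; split=> //.
rewrite -(res_comp Ws WZW) e (res_comp _ _ lt) -(res_comp Zt WZZ) k.
exact: res_comp.
Qed.

Lemma germ_add_eqv s s' t t' :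
  germ_eqv s s' -> germ_eqv t t' -> germ_eqv (germ_add s t) (germ_add s' t').
Proof. by apply: germ_op_eqv => U V h a b; rewrite rmorphD. Qed.

Lemma germ_mul_eqv s s' t t' :
  germ_eqv s s' -> germ_eqv t t' -> germ_eqv (germ_mul s t) (germ_mul s' t').
Proof. by apply: germ_op_eqv => U V h a b; rewrite rmorphM. Qed.

Lemma germ_opp_eqv s s' :
  germ_eqv s s' -> germ_eqv (germ_opp s) (germ_opp s').
Proof.
by move=> [W [Ws [Ws' [Wx e]]]]; exists W, Ws, Ws'; rewrite /= !rmorphN e.
Qed.

Lemma res_res (U V W : opens X) (h : V `<=` U) (k : W `<=` V) (a : F U) :
  res k (res h a) = res (subset_trans k h) a.
Proof. exact: res_comp. Qed.

Lemma res_irr (U V : opens X) (h k : V `<=` U) (a : F U) : res h a = res k a.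
Proof. by congr (res _ a); exact: Prop_irrelevance. Qed.

Lemma germ_eqv_on (W : opens X) s t (Ws : W `<=` germ_dom s)
  (Wt : W `<=` germ_dom t) : opens_set W x ->
  res Ws (germ_sec s) = res Wt (germ_sec t) -> germ_eqv s t.
Proof. by move=> Wx e; exists W, Ws, Wt. Qed.

Lemma germ_addA s t r :
  germ_eqv (germ_add s (germ_add t r)) (germ_add (germ_add s t) r).
Proof.
apply: (@germ_eqv_on (germ_dom (germ_add s (germ_add t r)))) => //=.
- by move=> y [? [? ?]].
- by do !split; exact: germ_mem.
by move=> h k; rewrite !(rmorphD, res_res) addrA; congr (_ + _ + _);
  exact: res_irr.
Qed.

Lemma germ_mulA s t r :
  germ_eqv (germ_mul s (germ_mul t r)) (germ_mul (germ_mul s t) r).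
Proof.
apply: (@germ_eqv_on (germ_dom (germ_mul s (germ_mul t r)))) => //=.
- by move=> y [? [? ?]].
- by do !split; exact: germ_mem.
by move=> h k; rewrite !(rmorphM, res_res) mulrA; congr (_ * _ * _);
  exact: res_irr.
Qed.

Lemma germ_addC s t : germ_eqv (germ_add s t) (germ_add t s).
Proof.
apply: (@germ_eqv_on (germ_dom (germ_add s t))) => //=.
- by move=> y [].
- by split; exact: germ_mem.
by move=> h k; rewrite !(rmorphD, res_res) addrC; congr (_ + _); exact: res_irr.
Qed.

Lemma germ_mulC s t : germ_eqv (germ_mul s t) (germ_mul t s).
Proof.
apply: (@germ_eqv_on (germ_dom (germ_mul s t))) => //=.
- by move=> y [].
- by split; exact: germ_mem.
by move=> h k; rewrite !(rmorphM, res_res) mulrC; congr (_ * _); exact: res_irr.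
Qed.

Lemma germ_add0 s : germ_eqv (germ_add (germC 0) s) s.
Proof.
apply: (@germ_eqv_on (germ_dom s)) => //=; first exact: germ_mem.
by move=> h k; rewrite !(rmorphD, res_res, rmorph0) add0r; exact: res_irr.
Qed.

Lemma germ_mul1 s : germ_eqv (germ_mul (germC 1) s) s.
Proof.
apply: (@germ_eqv_on (germ_dom s)) => //=; first exact: germ_mem.
by move=> h k; rewrite !(rmorphM, res_res, rmorph1) mul1r; exact: res_irr.
Qed.

Lemma germ_addN s : germ_eqv (germ_add (germ_opp s) s) (germC 0).
Proof.
apply: (@germ_eqv_on (germ_dom s)) => //=; first exact: germ_mem.
move=> h k; rewrite !(rmorphD, rmorphN, res_res, rmorph0) addrC.
by apply/eqP; rewrite subr_eq0; apply/eqP/res_irr.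
Qed.

Lemma germ_mulDl s t r : germ_eqv (germ_mul (germ_add s t) r)
  (germ_add (germ_mul s r) (germ_mul t r)).
Proof.
apply: (@germ_eqv_on (germ_dom (germ_mul (germ_add s t) r))) => //=.
- by move=> y [[? ?] ?].
- by do !split; exact: germ_mem.
move=> h k; rewrite !(rmorphM, rmorphD, res_res) mulrDl.
by congr (_ * _ + _ * _); exact: res_irr.
Qed.

Definition stalk_preRing : preComRing :=
  @PreComRing germ_rep germ_eqv (germC 0) (germC 1)
    germ_add germ_opp germ_mul
    germ_refl germ_sym germ_trans germ_add_eqv germ_opp_eqv germ_mul_eqv
    germ_addA germ_addC germ_add0 germ_addN germ_mulA germ_mulC germ_mul1
    germ_mulDl.

Definition stalk : comPzRingType := ring_quot stalk_preRing.

End Stalk.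

(** The sections of the structure sheaf of Spec A over V are the functions
    p |-> s p in A_p that are locally on V fractions a / f; the values outside
    V are irrelevant. *)

Section StructureSheaf.
Variable A : comPzRingType.

Section Sections.
Variable V : opens (Spec A).

Definition locally_fraction (s : forall p : Spec A, localization p) :=
  forall p, opens_set V p -> exists W : opens (Spec A),
    [/\ opens_set W p, W `<=` V & exists a f : A, forall q, opens_set W q ->
      exists fq : ~ prime_set q f, s q = loc_frac a fq].

Definition spec_sec := {s : forall p, localization p | locally_fraction s}.
Implicit Types s t : spec_sec.

Definition spec_eqv s t := forall p, opens_set V p -> sval s p = sval t p.

Lemma prime_complM (q : Spec A) f g :
  ~ prime_set q f -> ~ prime_set q g -> ~ prime_set q (f * g).
Proof. exact: (prime_compl_multiplicative q).2. Qed.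

Lemma loc_fracD (q : Spec A) a f b g (fq : ~ prime_set q f)
  (gq : ~ prime_set q g) (fgq : ~ prime_set q (f * g)) :
  loc_frac a fq + loc_frac b gq = loc_frac (a * g + b * f) fgq.
Proof.
rewrite -qclsD; congr (qcls (P := frac_preRing _ _)).
by congr pair; exact: eq_exist.
Qed.

Lemma loc_fracM (q : Spec A) a f b g (fq : ~ prime_set q f)
  (gq : ~ prime_set q g) (fgq : ~ prime_set q (f * g)) :
  loc_frac a fq * loc_frac b gq = loc_frac (a * b) fgq.
Proof.
rewrite -qclsM; congr (qcls (P := frac_preRing _ _)).
by congr pair; exact: eq_exist.
Qed.

Lemma loc_fracN (q : Spec A) a f (fq : ~ prime_set q f) :
  - loc_frac a fq = loc_frac (- a) fq.
Proof. by rewrite -qclsN. Qed.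

Lemma locally_fraction0 : locally_fraction (fun=> 0).
Proof.
move=> p Vp; exists V; split=> //; exists 0, 1 => q _.
by case: (prime_setP q) => _ q1 _; exists q1; rewrite -(rmorph0 (loc_map q));
  congr (qcls (P := frac_preRing _ _)); congr pair; exact: eq_exist.
Qed.

Lemma locally_fraction1 : locally_fraction (fun=> 1).
Proof.
move=> p Vp; exists V; split=> //; exists 1, 1 => q _.
by case: (prime_setP q) => _ q1 _; exists q1; rewrite -(rmorph1 (loc_map q));
  congr (qcls (P := frac_preRing _ _)); congr pair; exact: eq_exist.
Qed.

Lemma locally_fractionN s : locally_fraction (fun p => - sval s p).
Proof.
move=> p /(svalP s)[W [Wp WV [a [f h]]]]; exists W; split=> //.
by exists (- a), f => q /h[fq ->]; exists fq; rewrite loc_fracN.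
Qed.

Lemma locally_fractionD s t : locally_fraction (fun p => sval s p + sval t p).
Proof.
move=> p Vp; have [W [Wp WV [a [f h]]]] := svalP s p Vp.
have [Z [Zp ZV [b [g k]]]] := svalP t p Vp.
exists (opensI W Z); split=> //; first by move=> y [/WV].
exists (a * g + b * f), (f * g) => q [/h[fq ->] /k[gq ->]].
by exists (prime_complM fq gq); exact: loc_fracD.
Qed.

Lemma locally_fractionM s t : locally_fraction (fun p => sval s p * sval t p).
Proof.
move=> p Vp; have [W [Wp WV [a [f h]]]] := svalP s p Vp.
have [Z [Zp ZV [b [g k]]]] := svalP t p Vp.
exists (opensI W Z); split=> //; first by move=> y [/WV].
exists (a * b), (f * g) => q [/h[fq ->] /k[gq ->]].
by exists (prime_complM fq gq); exact: loc_fracM.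
Qed.

Definition spec_sec_preRing : preComRing.
Proof.
refine (@PreComRing spec_sec spec_eqv
  (exist _ _ locally_fraction0) (exist _ _ locally_fraction1)
  (fun s t => exist _ _ (locally_fractionD s t))
  (fun s => exist _ _ (locally_fractionN s))
  (fun s t => exist _ _ (locally_fractionM s t))
  _ _ _ _ _ _ _ _ _ _ _ _ _ _).
- abstract by [].
- abstract by move=> s t h p Vp; rewrite h.
- abstract by move=> s t r h k p Vp; rewrite h ?k.
- abstract by move=> s s' t t' h k p Vp /=; rewrite h ?k.
- abstract by move=> s s' h p Vp /=; rewrite h.
- abstract by move=> s s' t t' h k p Vp /=; rewrite h ?k.
- abstract by move=> s t r p Vp /=; rewrite addrA.
- abstract by move=> s t p Vp /=; rewrite addrC.
- abstract by move=> s p Vp /=; rewrite add0r.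
- abstract by move=> s p Vp /=; rewrite addNr.
- abstract by move=> s t r p Vp /=; rewrite mulrA.
- abstract by move=> s t p Vp /=; rewrite mulrC.
- abstract by move=> s p Vp /=; rewrite mul1r.
- abstract by move=> s t r p Vp /=; rewrite mulrDl.
Defined.

Definition spec_sections : comPzRingType := ring_quot spec_sec_preRing.

End Sections.

Section Restriction.
Variables (U V : opens (Spec A)) (VU : V `<=` U).

Lemma locally_fraction_res s : locally_fraction U s -> locally_fraction V s.
Proof.
move=> h p Vp; have [W [Wp WU [a [f k]]]] := h p (VU Vp).
exists (opensI W V); split=> //; first by move=> y [].
by exists a, f => q [/k].
Qed.

Definition spec_res_rep (s : spec_sec U) : spec_sec V :=
  exist _ (sval s) (locally_fraction_res (svalP s)).

Definition spec_res (s : spec_sections U) : spec_sections V :=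
  @qcls (spec_sec_preRing V) (spec_res_rep (qrepr s)).

Lemma spec_resE (s : spec_sec U) :
  spec_res (@qcls (spec_sec_preRing U) s) =
  @qcls (spec_sec_preRing V) (spec_res_rep s).
Proof.
by apply/qclsP => p Vp /=; exact: (@qrepr_eqv (spec_sec_preRing U) s) (VU Vp).
Qed.

Lemma spec_res_additive : zmod_morphism spec_res.
Proof.
move=> s t; rewrite -(qreprK s) -(qreprK t) -qclsN -qclsD !spec_resE.
by rewrite -qclsN -qclsD; exact/qclsP.
Qed.

Lemma spec_res_multiplicative : monoid_morphism spec_res.
Proof.
split=> [|s t].
  by rewrite -[1]/(@qcls (spec_sec_preRing U) _) spec_resE; exact/qclsP.
rewrite -(qreprK s) -(qreprK t) -qclsM !spec_resE -qclsM.
exact/qclsP.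
Qed.

HB.instance Definition _ := GRing.isZmodMorphism.Build
  (spec_sections U) (spec_sections V) spec_res spec_res_additive.
HB.instance Definition _ := GRing.isMonoidMorphism.Build
  (spec_sections U) (spec_sections V) spec_res spec_res_multiplicative.

End Restriction.

Definition Spec_sheaf : presheaf (Spec A).
Proof.
refine (@Presheaf (Spec A) spec_sections (fun U V h => spec_res h) _ _).
- by move=> U h s; rewrite -(qreprK s) /= spec_resE; exact/qclsP.
- by move=> U V W h k l s; rewrite -(qreprK s) /= !spec_resE; exact/qclsP.
Defined.

End StructureSheaf.

Record lrSpace := LRSpace {
  lr_top :> topologicalType;
  lr_sheaf : presheaf lr_top;
  lr_sheafP : is_sheaf lr_sheaf;
  lr_local : forall x, local_ring (stalk lr_sheaf x)
}.

Section OpenImmersion.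
Variables (Y X : topologicalType) (j : Y -> X).

Definition open_map := forall V : set Y, open V -> open (j @` V).

Definition opens_image (hj : open_map) (V : opens Y) : opens X :=
  MkOpens (hj V (opensP V)).

Lemma opens_imageS (hj : open_map) (U V : opens Y) : V `<=` U ->
  opens_image hj V `<=` opens_image hj U.
Proof. exact: image_subset. Qed.

Arguments opens_imageS hj {U V} _.

(** (Y, G) is isomorphic through j to an open subspace of (X, F). *)
Definition open_immersion (G : presheaf Y) (F : presheaf X) :=
  [/\ continuous j, injective j & exists (hj : open_map)
    (psi : forall V : opens Y, {rmorphism F (opens_image hj V) -> G V}),
    (forall V, bijective (psi V)) /\
    (forall (U V : opens Y) (VU : V `<=` U) s,
       psi V (res (opens_imageS hj VU) s) = res VU (psi U s))].

End OpenImmersion.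

(** The affine opens of X isomorphic to the spectrum of a ring satisfying P
    cover X. *)
Definition covered_by_spectra (P : comPzRingType -> Prop) (X : lrSpace) :=
  forall x : X, exists (A : comPzRingType) (j : Spec A -> X),
    [/\ P A, open_immersion j (Spec_sheaf A) (lr_sheaf X) & range j x].

Definition is_scheme : lrSpace -> Prop := covered_by_spectra (fun=> True).

Definition locally_noetherian : lrSpace -> Prop :=
  covered_by_spectra noetherian.

Definition excellent_scheme (X : lrSpace) :=
  [/\ is_scheme X, locally_noetherian X & covered_by_spectra excellent_ring X].

(** [cover_compact] does not include any separation axiom. *)
Definition retrocompact (X : topologicalType) (U : set X) :=
  forall W : set X, open W -> cover_compact W -> cover_compact (U `&` W).

Definition constructible (X : topologicalType) (E : set X) :=
  exists (n : nat) (U V : 'I_n -> set X),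
    (forall i, [/\ open (U i), retrocompact (U i),
                   open (V i) & retrocompact (V i)]) /\
    E = \bigcup_i (U i `&` ~` V i).

(** The difference is taken in [int] rather than with the truncated
    subtraction of [nat]. *)
Definition embedding_codim (X : lrSpace) (x : X) : int :=
  (edim (stalk (lr_sheaf X) x))%:Z - (krull_dim (stalk (lr_sheaf X) x))%:Z.

(* Main.v *)
Require Import Defs.
From HB Require Import structures.
From mathcomp Require Import all_boot all_order all_algebra ring.
From mathcomp Require Import boolp classical_sets topology zify finmap.

(** By noetherian induction it suffices that the defect edim - dim is constant
    on a nonempty open subset of V(p) for every prime p of an excellent ring A.
    By J-2 the local rings (A / p)_q are regular for q in such a subset.  A
    regular system of parameters of (A / p)_q is a regular sequence, so that
    p A_q meets the square of the maximal ideal of A_q in q p A_q only; as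
    p / p^2 is moreover generically free over A / p, this gives
    edim A_q = edim A_p + edim (A / p)_q.  Catenarity gives
    dim A_q = dim A_p + dim (A / p)_q, and the last terms of the two sums
    agree. *)

(** In each of the two additivity formulas only one half is delicate. A basis of the cotangent space
    at p, together with a system of parameters of (A / p)_q, generates the maximal ideal of A_q
    modulo its square as soon as one denominator is inverted; what could fail is independence. For a
    regular system of parameters x of (A / p)_q one has (x) ∩ p = (x) p at q, while q^2 lies in (x)
    + q p; together these put p ∩ q^2 inside q p. For dimensions, concatenation of chains gives one
    inequality; the other needs catenarity and the removal of the minimal primes that are not below
    p, since A need not be a domain.

    The regular locus of A / p is nonempty because (A / p)_p is a field. Krull's height theorem
    enters twice: it bounds chains, so that dimensions are honest natural numbers and not the
    default value of [krull_dim], and it keeps a parameter out of the prime at which a longest chain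
    starts.

    On a quasi-compact locally Noetherian scheme every open set is quasi-compact, so
    retrocompactness is automatic and finitely many affine charts suffice. *)

Set Implicit Arguments.
Unset Strict Implicit.
Unset Printing Implicit Defensive.

Import GRing.Theory.

Local Open Scope classical_set_scope.
Local Open Scope ring_scope.

(** * Krull's principal ideal theorem *)

Section Ideals.
Variable A : comPzRingType.
Implicit Types (I J K Q p q : set A) (s : seq A).

Lemma ideal0 I : is_ideal I -> I 0. Proof. by case. Qed.

Lemma idealD I a b : is_ideal I -> I a -> I b -> I (a + b).
Proof. by case=> _ h _; exact: h. Qed.

Lemma idealM I a b : is_ideal I -> I b -> I (a * b).
Proof. by case=> _ _ h; exact: h. Qed.

Lemma idealB I a b : is_ideal I -> I a -> I b -> I (a - b).
Proof. by move=> hI Ia Ib; apply: idealD => //; exact: is_idealN. Qed.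

Lemma ideal_sum I (T : Type) (r : seq T) (F : T -> A) :
  is_ideal I -> (forall i, I (F i)) -> I (\sum_(i <- r) F i).
Proof.
by move=> hI hF; apply: (big_ind I) => //; [exact: ideal0|move=> *; exact: idealD].
Qed.

Lemma prime_ideal q : is_prime q -> is_ideal q. Proof. by case. Qed.

Lemma prime_neq1 q : is_prime q -> ~ q 1. Proof. by case. Qed.

Lemma prime_notM q a b : is_prime q -> ~ q a -> ~ q b -> ~ q (a * b).
Proof. by case=> _ _ h na nb /h[]. Qed.

Lemma prime_cancel q a b : is_prime q -> ~ q a -> q (a * b) -> q b.
Proof. by case=> _ _ h na /h[]. Qed.

Lemma not_prime_factors K : is_ideal K -> ~ K 1 -> ~ is_prime K ->
  exists a b, [/\ K (a * b), ~ K a & ~ K b].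
Proof.
move=> hK nK1 npK; apply: contrapT => nex; apply: npK; split=> // a b Kab.
by apply: contrapT => /not_orP[nKa nKb]; apply: nex; exists a, b.
Qed.

Lemma ideal_gen_sub I (E : set A) : is_ideal I -> E `<=` I -> ideal_gen E `<=` I.
Proof. by move=> hI EI z; apply. Qed.

Lemma sub_ideal_gen (E : set A) : E `<=` ideal_gen E.
Proof. by move=> z Ez I [_]; apply. Qed.

Definition addi I J : set A := [set z | exists2 u, I u & J (z - u)].

Lemma is_ideal_addi I J : is_ideal I -> is_ideal J -> is_ideal (addi I J).
Proof.
move=> hI hJ; split=> [|a b [u Iu Ju] [v Iv Jv]|a b [u Iu Ju]].
- by exists 0; rewrite ?subr0; exact: ideal0.
- exists (u + v); first exact: idealD.
  by rewrite opprD addrACA; exact: idealD.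
- by exists (a * u); rewrite -?mulrBr; exact: idealM.
Qed.

Lemma addil I J : is_ideal J -> I `<=` addi I J.
Proof. by move=> hJ z Iz; exists z; rewrite ?subrr //; exact: ideal0. Qed.

Lemma addir I J : is_ideal I -> J `<=` addi I J.
Proof. by move=> hI z Iz; exists 0; rewrite ?subr0 //; exact: ideal0. Qed.

Lemma addi_sub I J K : is_ideal K -> I `<=` K -> J `<=` K -> addi I J `<=` K.
Proof.
by move=> hK IK JK z [u /IK Iu /JK Ju]; rewrite -(subrK u z); exact: idealD.
Qed.

Lemma addi0 I : addi I [set 0] = I.
Proof.
apply/seteqP; split=> z; last by move=> Iz; exists z; rewrite //= subrr.
by move=> [u Iu /= /eqP]; rewrite subr_eq0 => /eqP->.
Qed.

Definition adjoin I x : set A := [set z | exists a, I (z - a * x)].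

Lemma is_ideal_adjoin I x : is_ideal I -> is_ideal (adjoin I x).
Proof.
move=> hI; split=> [|a b [u Iu] [v Iv]|a b [u Iu]].
- by exists 0; rewrite mul0r subr0; exact: ideal0.
- by exists (u + v); rewrite mulrDl opprD addrACA; exact: idealD.
- by exists (a * u); rewrite -mulrA -mulrBr; exact: idealM.
Qed.

Lemma sub_adjoin I x : I `<=` adjoin I x.
Proof. by move=> z Iz; exists 0; rewrite mul0r subr0. Qed.

Lemma adjoin_mem I x : is_ideal I -> adjoin I x x.
Proof. by move=> hI; exists 1; rewrite mul1r subrr; exact: ideal0. Qed.

Lemma adjoin_sub I J x : is_ideal J -> I `<=` J -> J x -> adjoin I x `<=` J.
Proof.
move=> hJ IJ Jx z [a /IJ h]; rewrite -(subrK (a * x) z).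
by apply: idealD => //; exact: idealM.
Qed.

(** The product of the ideals [Q] and (s), as combinations of [s] with coefficients in [Q]: the
    whole ring for [Q] gives the ideal (s), and a prime q gives q (s), the submodule that occurs in
    Nakayama's lemma. *)
Fixpoint mspan Q s : set A :=
  if s is x :: s' then [set z | exists2 a, Q a & mspan Q s' (z - a * x)]
  else [set 0].

Local Notation lspan := (mspan [set: A]).

Lemma is_idealT : is_ideal [set: A]. Proof. by split. Qed.
Hint Resolve is_idealT : core.

Lemma is_ideal_mspan Q s : is_ideal Q -> is_ideal (mspan Q s).
Proof.
move=> hQ; elim: s => [|x s IH] /=; first exact: is_ideal0.
split=> [|a b [u Iu Su] [v Iv Sv]|a b [u Iu Su]].
- by exists 0; rewrite ?mul0r ?subr0; [exact: ideal0|exact: ideal0].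
- exists (u + v); first exact: idealD.
  by rewrite mulrDl opprD addrACA; exact: idealD.
- exists (a * u); first exact: idealM.
  by rewrite -mulrA -mulrBr; exact: idealM.
Qed.

Lemma mspan_le Q s K : is_ideal K ->
  (forall a x, Q a -> x \in s -> K (a * x)) -> mspan Q s `<=` K.
Proof.
move=> hK; elim: s => [|x s IH] h z /=; first by move=> ->; exact: ideal0.
move=> [a Qa /IH Kz]; rewrite -(subrK (a * x) z); apply: idealD => //.
  by apply: Kz => b y Qb ys; apply: h; rewrite // inE ys orbT.
by apply: h; rewrite // mem_head.
Qed.

Lemma mspan_sub I s : is_ideal I -> (forall x, x \in s -> I x) -> lspan s `<=` I.
Proof. by move=> hI sI; apply: mspan_le => // a x _ /sI; exact: idealM. Qed.

Lemma mspan_subl Q s : is_ideal Q -> mspan Q s `<=` Q.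
Proof.
by move=> hQ; apply: mspan_le => // a x Qa _; rewrite mulrC; exact: idealM.
Qed.

Lemma mspan_mono Q Q' s : Q `<=` Q' -> mspan Q s `<=` mspan Q' s.
Proof.
by move=> QQ'; elim: s => [//|x s IH] z /= [a /QQ' Qa /IH h]; exists a.
Qed.

Lemma mspan_mem s x : x \in s -> lspan s x.
Proof.
elim: s => [//|y s IH]; rewrite inE => /orP[/eqP->|/IH h] /=.
  by exists 1 => //; rewrite mul1r subrr; apply: ideal0; exact: is_ideal_mspan.
by exists 0 => //; rewrite mul0r subr0.
Qed.

Lemma mspan_scale Q s a z : is_ideal Q -> Q a -> lspan s z -> mspan Q s (a * z).
Proof.
move=> hQ Qa; elim: s z => [|x s IH] z /=; first by move=> ->; rewrite mulr0.
move=> [b _ /IH h]; exists (a * b); first by rewrite mulrC; exact: idealM.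
by rewrite -mulrA -mulrBr.
Qed.

Lemma ideal_gen_seq s : ideal_gen [set` s] = lspan s.
Proof.
apply/seteqP; split=> [|z].
  apply: ideal_gen_sub => [|x /= xs]; first exact: is_ideal_mspan.
  exact: mspan_mem.
apply: mspan_sub => [|x xs]; first exact: is_ideal_gen.
exact: sub_ideal_gen.
Qed.

Lemma noetherian_span I : noetherian A -> is_ideal I -> exists s, I = lspan s.
Proof. by move=> nA /nA[s ->]; exists s; exact: ideal_gen_seq. Qed.

(** A counterexample would yield, by dependent choice, a strictly increasing sequence of
    counterexamples; their union is finitely generated, hence contained in one of them. *)
Lemma noetherian_ind (P : set A -> Prop) : noetherian A ->
  (forall K, is_ideal K ->
     (forall K', is_ideal K' -> K `<` K' -> P K') -> P K) ->
  forall K, is_ideal K -> P K.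
Proof.
move=> nA step K hK; apply: contrapT => nPK.
pose bad := {L : set A | is_ideal L /\ ~ P L}.
have next (L : bad) : {L' : bad | sval L `<` sval L'}.
  apply: cid; case: L => L [hL nPL] /=; apply: contrapT => nex.
  apply/nPL/step => // L' hL' LL'; apply: contrapT => nPL'.
  by apply: nex; exists (exist _ L' (conj hL' nPL')).
pose F n : bad := iter n (fun L => sval (next L))
  (exist (fun L => is_ideal L /\ ~ P L) K (conj hK nPK)).
have hF n : is_ideal (sval (F n)) by case: (F n) => L [].
have FS n : sval (F n) `<` sval (F n.+1) by rewrite /F /=; case: (next _).
have Fle m n : (m <= n)%N -> sval (F m) `<=` sval (F n).
  move=> /subnK <-; elim: (n - m)%N => // k IH.
  by apply: subset_trans IH _; exact: (FS _).1.
pose U : set A := \bigcup_n sval (F n).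
have hU : is_ideal U.
  split=> [|a b [m _ Fa] [n _ Fb]|a b [n _ Fb]].
  - by exists 0%N => //; exact: ideal0.
  - exists (maxn m n) => //; apply: idealD => //.
    + by apply: Fle Fa; exact: leq_maxl.
    + by apply: Fle Fb; exact: leq_maxr.
  - by exists n => //; exact: idealM.
have [s Us] := noetherian_span nA hU.
have : exists n, forall x, x \in s -> sval (F n) x.
  have : forall x, x \in s -> U x by move=> x xs; rewrite Us; exact: mspan_mem.
  elim: {Us} s => [|x s IH] sU; first by exists 0%N.
  have [m hm] : exists m, forall y, y \in s -> sval (F m) y.
    by apply: IH => y ys; apply: sU; rewrite inE ys orbT.
  have [n _ hn] : U x by apply: sU; rewrite mem_head.
  exists (maxn m n) => y; rewrite inE => /orP[/eqP->|ys].
    by apply: Fle hn; exact: leq_maxr.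
  by apply: Fle (hm _ ys); exact: leq_maxl.
move=> [n hn]; apply: (FS n).2 => x Fx.
have : U x by exists n.+1.
by rewrite Us; apply: mspan_sub.
Qed.

(** Kernel of A -> (A / I)_q; equalities and memberships that hold in the
    localization at q are expressed in A with [sat q]. *)
Definition sat q I : set A := [set a | exists2 t, ~ q t & I (t * a)].

Lemma sub_sat q I : is_prime q -> I `<=` sat q I.
Proof. by move=> [_ q1 _] a Ia; exists 1; rewrite ?mul1r. Qed.

Lemma is_ideal_sat q I : is_prime q -> is_ideal I -> is_ideal (sat q I).
Proof.
move=> pq hI; split=> [|a b [t qt Ia] [u qu Ib]|a b [t qt Ib]].
- by apply: sub_sat => //; exact: ideal0.
- exists (t * u); first exact: prime_notM.
  have -> : t * u * (a + b) = u * (t * a) + t * (u * b) by ring.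
  exact: is_idealL.
- by exists t => //; rewrite mulrCA; exact: idealM.
Qed.

Lemma sat_mono q I J : I `<=` J -> sat q I `<=` sat q J.
Proof. by move=> IJ a [t qt /IJ]; exists t. Qed.

Lemma sat_sat q I : is_prime q -> sat q (sat q I) `<=` sat q I.
Proof.
move=> pq a [t qt [u qu h]]; exists (u * t); first exact: prime_notM.
by rewrite -mulrA.
Qed.

Lemma sat_scale q I t a : is_prime q -> ~ q t -> sat q I (t * a) -> sat q I a.
Proof. by move=> pq qt h; apply: sat_sat => //; exists t. Qed.

Lemma sat_prime q p : is_prime p -> p `<=` q -> sat q p `<=` p.
Proof. by move=> pp pq a [t qt]; apply: prime_cancel => // /pq. Qed.

Lemma sat_sub q I p : is_prime p -> p `<=` q -> I `<=` p -> sat q I `<=` p.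
Proof. by move=> pp pq Ip; apply: subset_trans (sat_mono Ip) (sat_prime pp pq). Qed.

(** Nakayama's lemma at q with a single denominator for all of (s). Generators are eliminated one at
    a time: modulo J and the remaining ones, t x = b x with b in q, and t - b is a unit at q. *)
Lemma local_nakayama q J s : is_prime q -> is_ideal J ->
  lspan s `<=` sat q (addi (mspan q s) J) ->
  exists2 t, ~ q t & forall a, lspan s a -> J (t * a).
Proof.
move=> pq hJ; have hq := prime_ideal pq.
elim: s => [|x s IH] h.
  exists 1; first exact: prime_neq1.
  by move=> a ->; rewrite mulr0; exact: ideal0.
have [t qt [w [b qb /= hw] hJx]] := h x (mspan_mem (mem_head x s)).
have qu : ~ q (t - b) by move=> k; apply: qt; rewrite -(subrK b t); exact: idealD.
have hs := is_ideal_mspan s hq; have hsJ := is_ideal_addi hs hJ.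
have xJ : addi (mspan q s) J ((t - b) * x).
  exists (w - b * x) => //.
  by have -> : (t - b) * x - (w - b * x) = t * x - w by ring.
have [v qv vJ] : exists2 v, ~ q v & forall a, lspan s a -> J (v * a).
  apply: IH => a sa.
  have : lspan (x :: s) a by exists 0 => //; rewrite mul0r subr0.
  move=> /h[r qr [y [c qc /= hy] hJa]].
  exists ((t - b) * r); first exact: prime_notM.
  have -> : (t - b) * r * a =
    (t - b) * (y - c * x) + c * ((t - b) * x) + (t - b) * (r * a - y) by ring.
  apply: idealD => //; last by apply: (addir hs); exact: idealM.
  apply: idealD => //; last exact: idealM.
  by apply: (addil hJ); exact: idealM.
exists (v * (t - b)); first exact: prime_notM.
move=> a [c _ /= sc].
have vx : J (v * ((t - b) * x)).
  move: xJ => [y yq]; set z := _ - y => zJ.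
  have -> : v * ((t - b) * x) = v * y + v * z by rewrite /z; ring.
  apply: idealD => //; last exact: idealM.
  by apply: vJ; exact: mspan_mono yq.
have -> : v * (t - b) * a = c * (v * ((t - b) * x)) + (t - b) * (v * (a - c * x)).
  by ring.
by apply: is_idealL => //; exact: vJ.
Qed.

(** Existence of an associated prime of A / K: if a b kills z modulo K while neither a nor b does,
    then the annihilator of b z is still proper and strictly larger, since it also contains a. *)
Lemma colon_prime K y : noetherian A -> is_ideal K -> ~ K y ->
  exists y', is_prime [set a | K (a * y')].
Proof.
move=> nA hK; have colonI z : is_ideal [set a | K (a * z)].
  split=> [|a b|a b] /=; first by rewrite mul0r; exact: ideal0.
  - by rewrite mulrDl; exact: idealD.
  - by rewrite -mulrA; exact: idealM.
pose P L := forall z, L = [set a | K (a * z)] -> ~ K z ->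
  exists y', is_prime [set a | K (a * y')].
suff: forall L, is_ideal L -> P L by move=> /(_ _ (colonI y)); exact.
apply: (noetherian_ind (P := P)) => // L hL IH z LE Kz.
have [pz|npz] := pselect (is_prime [set a | K (a * z)]); first by exists z.
have nL1 : ~ K (1 * z) by rewrite mul1r.
have [a [b [/= abz Kaz Kbz]]] := not_prime_factors (colonI z) nL1 npz.
apply: (IH _ (colonI (b * z)) _ (b * z)) => //; rewrite LE; split=> [c /=|].
  by rewrite mulrCA; exact: idealM.
by move=> /(_ a) /=; rewrite mulrA => /(_ abz).
Qed.

(** The ring (A / K)_q is Artinian when its spectrum is the point q. *)
Lemma sat_dcc q K (I : nat -> set A) : noetherian A -> is_prime q ->
  is_ideal K ->
  (forall P, is_prime P -> K `<=` P -> P `<=` q -> q `<=` P) ->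
  (forall n, is_ideal (I n)) -> (forall n, K `<=` I n) ->
  (forall n, I n.+1 `<=` I n) -> (forall n, sat q (I n) `<=` I n) ->
  exists n, I n `<=` I n.+1.
Proof.
move=> nA pq hK; have hq := prime_ideal pq.
move: K hK I; apply: noetherian_ind => // K hK IH I Kmin hI KI Idec Isat.
have hsK := is_ideal_sat pq hK.
have sKI n : sat q K `<=` I n by apply: subset_trans (sat_mono (KI n)) _.
have [K1|nK1] := pselect (sat q K 1).
  by exists 0%N => a _; rewrite -(mulr1 a); apply: idealM => //; exact: sKI.
(* The associated prime found here lies between K and q, so it is q by minimality: y spans a copy of
   the residue field in (A / K)_q, and induction applies to K + (y). *)
have [y pKy] := colon_prime nA hsK nK1.
have Kyq : [set a | sat q K (a * y)] `<=` q.
  move=> s /= Ksy; apply: contrapT => qs.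
  by apply: (prime_neq1 pKy) => /=; rewrite mul1r; exact: sat_scale Ksy.
have qKy : q `<=` [set a | sat q K (a * y)].
  by apply: Kmin => // a Ka /=; rewrite mulrC; apply: idealM => //; exact: sub_sat.
have nKy : ~ K y.
  by move=> Ky; apply: (prime_neq1 pKy) => /=; rewrite mul1r; exact: sub_sat.
have hKy : is_ideal (adjoin K y) by exact: is_ideal_adjoin.
have KKy : K `<` adjoin K y.
  by split; [exact: sub_adjoin|move=> /(_ y (adjoin_mem y hK))].
have minKy P : is_prime P -> adjoin K y `<=` P -> P `<=` q -> q `<=` P.
  by move=> pP KyP; apply: Kmin => //; apply: subset_trans (sub_adjoin _) KyP.
have [Iy|/existsNP[n0 nIy]] := pselect (forall n, I n y).
  by apply: (IH _ hKy KKy) => // n; exact: adjoin_sub.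
have Ile n : ~ I (n0 + n)%N y.
  by elim: n => [|n IHn]; rewrite ?addn0 ?addnS // => /Idec.
(* From [n0] on y is outside the chain, and adding it loses no information: if b y lies in some I m
   with m at least [n0], then b is in q by saturation, so that b y is already zero at q modulo K. *)
pose J n := sat q (adjoin (I (n0 + n)%N) y).
have hJ n : is_ideal (adjoin (I (n0 + n)%N) y) by exact: is_ideal_adjoin.
have [n hn] : exists n, J n `<=` J n.+1.
  apply: (IH _ hKy KKy) => // [n|n|n|n].
  - exact: is_ideal_sat.
  - apply: adjoin_sub; first exact: is_ideal_sat.
      by move=> a Ka; apply: sub_sat => //; apply: sub_adjoin; exact: KI.
    by apply: sub_sat => //; exact: adjoin_mem.
  - apply: sat_mono => a [b h]; exists b; apply: Idec.
    by rewrite addnS in h.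
  - exact: sat_sat.
exists (n0 + n)%N => a Ia.
have [t qt [b h]] : J n.+1 a by apply: hn; apply: sub_sat => //; exact: sub_adjoin.
rewrite addnS in h.
have Iby : I (n0 + n)%N (b * y).
  have -> : b * y = t * a - (t * a - b * y) by ring.
  by apply: idealB => //; [exact: idealM|exact: Idec].
have qb : q b.
  by apply: contrapT => qb; apply: (Ile n); apply: Isat; exists b.
apply: Isat; exists t => //; rewrite -(subrK (b * y) (t * a)).
by apply: idealD => //; apply: sKI; exact: qKy.
Qed.

(** Krull's principal ideal theorem: otherwise P2 is minimal over P0 + (x), so
    that the symbolic powers of P1 are stationary modulo x in the localization
    at P2, hence stationary by Nakayama's lemma, and P1 = P0. *)
Lemma krull_step (P0 P1 P2 : set A) x : noetherian A ->
  is_prime P0 -> is_prime P1 -> is_prime P2 ->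
  P0 `<` P1 -> P1 `<` P2 -> P2 x ->
  exists P, [/\ is_prime P, P0 `<` P, P `<` P2 & P x].
Proof.
move=> nA p0 p1 p2 [P01 nP10] [P12 nP21] P2x.
apply: contrapT => nex.
have h0 := prime_ideal p0; have h1 := prime_ideal p1; have h2 := prime_ideal p2.
have nP1x : ~ P1 x by move=> P1x; apply: nex; exists P1.
have nP0x : ~ P0 x by move=> /P01.
have Pmin P : is_prime P -> adjoin P0 x `<=` P -> P `<=` P2 -> P2 `<=` P.
  move=> pP xP PP2; apply: contrapT => nP2P; apply: nex; exists P.
  have Px : P x by apply: xP; exact: adjoin_mem.
  split=> //; split; first by apply: subset_trans (sub_adjoin _) xP.
  by move=> /(_ x Px).
have hX n := is_ideal_addi (is_idealX P1 n) h0.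
pose S n := sat P1 (addi (idealX P1 n) P0).
have hS n : is_ideal (S n) by exact: is_ideal_sat.
have XS n : idealX P1 n.+1 `<=` idealX P1 n.
  apply: ideal_gen_sub => [|_ [a [b [Xa _ ->]]]]; first exact: is_idealX.
  by rewrite mulrC; apply: idealM => //; exact: is_idealX.
have [n hn] : exists n, sat P2 (adjoin (S n) x) `<=` sat P2 (adjoin (S n.+1) x).
  apply: (sat_dcc (I := fun n => sat P2 (adjoin (S n) x)) nA p2 _ Pmin).
  - exact: is_ideal_adjoin.
  - by move=> n; apply: is_ideal_sat => //; exact: is_ideal_adjoin.
  - move=> n a [b P0b]; apply: sub_sat => //; exists b; apply: sub_sat => //.
    by apply: addir => //; exact: is_idealX.
  - move=> n; apply: sat_mono => a [b [t pt [u Xu P0u]]].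
    by exists b; exists t => //; exists u => //; exact: XS.
  - by move=> n; exact: sat_sat.
(* An element of S n is, at P2, an element of S n.+1 plus b x; since x is outside P1, b lies in S n
   again. Thus S n = S n.+1 + x S n at P2, with x in P2. *)
have SS : S n `<=` S n.+1.
  have [s Ss] := noetherian_span nA (hS n).
  have [t qt tS] : exists2 t, ~ P2 t & forall a, lspan s a -> S n.+1 (t * a).
    apply: local_nakayama => // a; rewrite -Ss => Sa.
    have [t qt [b h]] : sat P2 (adjoin (S n.+1) x) a.
      by apply: hn; apply: sub_sat => //; exact: sub_adjoin.
    exists t => //; exists (b * x) => //.
    rewrite mulrC; apply: mspan_scale => //; rewrite -Ss.
    have : S n (x * b).
      have -> : x * b = t * a - (t * a - b * x) by ring.
      apply: idealB => //; first exact: idealM.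
      apply: sat_mono h => z [u Xu P0u]; exists u => //; exact: XS.
    exact: sat_scale.
  move=> a; rewrite {1}Ss => /tS; apply: sat_scale => // P1t; apply: qt.
  exact: P12.
have [s Xs] := noetherian_span nA (is_idealX P1 n).
(* Now P1^n = P1^(n+1) modulo P0 at P1, so that P1^n vanishes there modulo P0. *)
have [t qt tX] : exists2 t, ~ P1 t & forall a, lspan s a -> P0 (t * a).
  apply: local_nakayama => // a; rewrite -Xs => Xa.
  have : S n.+1 a by apply: SS; apply: sub_sat => //; exact: addil.
  apply: sat_mono => z [u Xu P0u]; exists u => //; move: u Xu {P0u}.
  apply: ideal_gen_sub; first exact: is_ideal_mspan.
  by move=> _ [u [v [Xu P1v ->]]]; rewrite mulrC; apply: mspan_scale; rewrite -?Xs.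
have XP0 : idealX P1 n `<=` P0.
  rewrite Xs => a /tX; apply: prime_cancel => // P0t; apply: qt; exact: P01.
(* An element of P1 outside P0 can be cancelled, which lowers the exponent step by step down to
   P1^0, the whole ring. *)
elim: n XP0 {SS hn tX s Xs} => [|n IH] XP0; first by apply: (prime_neq1 p0); exact: XP0.
apply: IH => a Xa; have [b /not_implyP[P1b nP0b]] := (existsNP _).2 nP10.
apply: (prime_cancel p0 nP0b); rewrite mulrC; apply: XP0; apply: sub_ideal_gen.
by exists a, b.
Qed.

End Ideals.
#[local] Hint Resolve is_idealT : core.
Local Notation lspan := (mspan setT).

(** * Regular sequences *)

Section RelationalChains.
Variables (A : comPzRingType) (r : Spec A -> Spec A -> Prop).

(** Chains of length [n] with prescribed ends, as a relation: this makes concatenation and induction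
    on the first step immediate. The relation [r] is strict inclusion for arbitrary chains and
    [covers] for saturated ones. *)
Fixpoint rlink (n : nat) (P Q : Spec A) : Prop :=
  if n is m.+1 then exists2 R : Spec A, r P R & rlink m R Q else P = Q.

Lemma rlinkP n P Q : rlink n P Q <->
  exists F : nat -> Spec A, [/\ F 0%N = P, F n = Q &
    forall i, (i < n)%N -> r (F i) (F i.+1)].
Proof.
elim: n P => [|n IH] P; split=> /=.
- by move=> PQ; exists (fun=> P).
- by move=> [F [<- <-]].
- move=> [R PR /IH[F [F0 Fn Fr]]].
  exists (fun i => if i is j.+1 then F j else P); split=> // -[|i] //=.
    by rewrite F0.
  exact: Fr.
- move=> [F [<- Fn Fr]]; exists (F 1%N); first exact: Fr.
  by apply/IH; exists (F \o succn); split=> // i hi; exact: Fr.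
Qed.

Lemma rlink_cat m n P Q R : rlink m P Q -> rlink n Q R -> rlink (m + n) P R.
Proof.
by elim: m P => [P -> //|m IH P /= [S PS h] k]; exists S => //; exact: IH.
Qed.

End RelationalChains.

Definition spec_lt (A : comPzRingType) (P Q : Spec A) := (P : set A) `<` Q.
Notation link := (rlink (@spec_lt _)).

Section Chains.
Variable A : comPzRingType.
Implicit Types (P Q R q : Spec A) (I J : set A).

Lemma spec_eq P Q : (P : set A) = Q -> P = Q.
Proof.
case: P Q => [p pp] [q pq] /= pE; subst q; congr MkSpec; exact: Prop_irrelevance.
Qed.

Lemma spec_eq_sub P Q : (P : set A) `<=` Q -> (Q : set A) `<=` P -> P = Q.
Proof. by move=> PQ QP; apply: spec_eq; apply/seteqP. Qed.

Lemma spec_properP P Q : (P : set A) `<=` Q -> P <> Q -> (P : set A) `<` Q.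
Proof. by move=> PQ nPQ; split=> // QP; apply/nPQ/spec_eq_sub. Qed.

Lemma link_sub n P Q : link n P Q -> (P : set A) `<=` Q.
Proof.
elim: n P => [P -> //|n IH P /= [R [PR _] /IH RQ]].
exact: subset_trans PR RQ.
Qed.

Lemma link_gt0 P Q : (P : set A) `<=` Q -> P <> Q -> link 1 P Q.
Proof. by move=> PQ nPQ; exists Q => //; exact: spec_properP. Qed.

(** Working down from q, which contains x, each use of [krull_step] replaces a member of the chain
    by a prime that contains x. *)
Lemma link_through n P q x : noetherian A -> prime_set q x ->
  link n.+1 P q -> exists R : Spec A, [/\ (P : set A) `<` R, prime_set R x & link n R q].
Proof.
move=> nA qx; elim: n P => [|n IH] P [R PR]; first by move=> /= Rq; subst R; exists q.
move=> /IH[S [RS Sx lS]].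
have [T [pT PT TS Tx]] := krull_step nA (prime_setP P) (prime_setP R)
  (prime_setP S) PR RS Sx.
by exists (MkSpec pT); split=> //; exists S.
Qed.

Lemma addi_span_adjoin J x s :
  addi (lspan (x :: s)) J = addi (lspan s) (adjoin J x).
Proof.
apply/seteqP; split=> z [w].
  move=> [a _ /= sw] Jz; exists (w - a * x) => //; exists a.
  by have -> : z - (w - a * x) - a * x = z - w by ring.
move=> sw [a Jz]; exists (w + a * x); last by rewrite opprD addrA.
by exists a => //; rewrite addrK.
Qed.

(** Krull's height theorem for (A / I)_q: by [link_through], moving one generator into [I] shortens
    the chain by one step only. *)
Lemma height_le s I P q n : noetherian A -> is_ideal I ->
  (forall x, x \in s -> prime_set q x) ->
  (q : set A) `<=` sat q (addi (lspan s) I) ->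
  I `<=` P -> link n P q -> (n <= size s)%N.
Proof.
move=> nA; elim: s I P n => [|x s IH] I P [|n] hI sq qI IP // lP.
  have [R [PR nRP] /link_sub Rq] := lP; exfalso; apply: nRP => a /Rq /qI.
  apply: sat_sub; [exact: prime_setP|exact: subset_trans PR Rq|].
  by apply: addi_sub => //; [exact: prime_is_ideal|move=> _ ->;
    apply: ideal0; exact: prime_is_ideal].
have qx : prime_set q x by apply: sq; rewrite mem_head.
have [R [[PR _] Rx lR]] := link_through nA qx lP.
apply: (IH (adjoin I x) R) => //.
- exact: is_ideal_adjoin.
- by move=> y ys; apply: sq; rewrite inE ys orbT.
- by rewrite -addi_span_adjoin.
- apply: adjoin_sub => //; first exact: prime_is_ideal.
  exact: subset_trans IP PR.
Qed.

(** A regular system of parameters of (A / I)_q is a regular sequence, whence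
    the vanishing of Tor_1(A / I, A / (s)) at q in the second conclusion; the
    first one makes (A / I)_q a domain. *)
Lemma regular_sequence s I P q : noetherian A -> is_ideal I ->
  (forall x, x \in s -> prime_set q x) ->
  (q : set A) `<=` sat q (addi (lspan s) I) ->
  I `<=` P -> link (size s) P q ->
  (P : set A) `<=` sat q I /\ (lspan s `&` I `<=` sat q (mspan I s)).
Proof.
move=> nA; have pq := prime_setP q.
elim: s I P => [|x s IH] I P hI sq qI IP lP.
  split; first by move: lP => /= ->; apply: subset_trans qI _;
    apply: sat_mono; apply: addi_sub => // _ ->; exact: ideal0.
  by move=> _ [/= -> _]; exact: sub_sat.
have hP := prime_is_ideal P; have Pq := link_sub lP.
have qx : prime_set q x by apply: sq; rewrite mem_head.
have sq' y : y \in s -> prime_set q y by move=> ys; apply: sq; rewrite inE ys orbT.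
(* Otherwise the remaining elements [s] would generate q modulo P at q, and the chain from P to q
   would be longer than [height_le] allows. *)
have nPx : ~ prime_set P x.
  move=> Px; suff qP : (q : set A) `<=` sat q (addi (lspan s) P).
    by have := height_le nA hP sq' qP (@subset_refl _ _) lP; rewrite ltnn.
  apply: subset_trans qI _; rewrite addi_span_adjoin; apply: sat_mono.
  move=> z [w sw Iw]; exists w => //; move: Iw; exact: adjoin_sub.
have [R [[PR _] Rx lR]] := link_through nA qx lP.
have hIx := is_ideal_adjoin x hI.
have IxR : adjoin I x `<=` R.
  apply: adjoin_sub => //; first exact: prime_is_ideal.
  exact: subset_trans IP PR.
rewrite addi_span_adjoin in qI.
have [RI spI] := IH _ R hIx sq' qI IxR lR.
(* By induction P lies in I + (x) at q. As x is not in P, the coefficient of x is in P, so P = I + x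
   P at q and Nakayama's lemma applies. *)
have PI : (P : set A) `<=` sat q I.
  have [r Pr] := noetherian_span nA hP.
  have [t qt tP] : exists2 t, ~ prime_set q t & forall a, lspan r a -> I (t * a).
    apply: local_nakayama => // a; rewrite -Pr => Pa.
    have [t qt [b h]] := RI _ (PR _ Pa); exists t => //.
    exists (b * x) => //; rewrite mulrC; apply: mspan_scale => //.
      exact: prime_ideal.
    rewrite -Pr; apply: (prime_cancel (prime_setP P) nPx).
    have -> : x * b = t * a - (t * a - b * x) by ring.
    by apply: idealB => //; [exact: idealM|exact: IP].
  by move=> a; rewrite Pr => /tP; exists t.
split=> // z [[a _ /=]]; set w := z - _ => sw Iz.
have [t qt] : sat q (mspan (adjoin I x) s) w.
  by apply: spI; split=> //; exists (- a); rewrite mulNr opprK /w subrK.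
have adjoinE r y : mspan (adjoin I x) r y ->
    exists2 v, lspan r v & mspan I r (y - v * x).
  elim: r y => [|g r IHr] y /=; first by move=> ->; exists 0; rewrite ?mul0r ?subr0.
  move=> [c [d Id]] /IHr[v sv Iv]; exists (d * g + v).
    by exists d; rewrite // addrAC subrr add0r.
  by exists (c - d * x) => //; move: Iv; congr (mspan I r _); ring.
move=> /adjoinE[v sv]; set w' := _ - _ => Iw'.
(* Here t z = (t a + v) x + w' with v in (s) and w' in I (s). The coefficient of x lies in P because
   x does not, hence in I at q by [PI]. *)
have Ptav : prime_set P (t * a + v).
  apply: (prime_cancel (prime_setP P) nPx).
  have -> : x * (t * a + v) = t * z - w' by rewrite /w' /w; ring.
  apply: IP; apply: idealB => //; first exact: idealM.
  by apply: (mspan_subl hI) Iw'.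
have [u qu Iu] := PI _ Ptav; exists (u * t); first exact: prime_notM.
exists (u * (t * a + v)) => //.
have -> : u * t * z - u * (t * a + v) * x = u * w' by rewrite /w' /w; ring.
by apply: idealM => //; exact: is_ideal_mspan.
Qed.

End Chains.

(** * Dimension and embedding dimension of localized quotients *)

Section PrimeChains.
Variable A : comPzRingType.
Implicit Types (P Q R q : Spec A).

Lemma spec_lt_trans P Q R : spec_lt P Q -> spec_lt Q R -> spec_lt P R.
Proof.
move=> [PQ nQP] [QR _]; split; first exact: subset_trans PQ QR.
by move=> RP; apply: nQP; exact: subset_trans QR RP.
Qed.

Lemma prime_chain_nat n (F : nat -> Spec A) :
  (forall i, (i < n)%N -> spec_lt (F i) (F i.+1)) ->
  prime_chain (fun i : 'I_n.+1 => F i).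
Proof.
move=> hF i j ij; rewrite -(subnKC ij) addSnnS.
have : (i + (j - i.+1).+1 <= n)%N by rewrite -addSnnS subnKC // -ltnS.
elim: (j - _)%N => [|k IH] h; first by rewrite addn1; apply: hF; rewrite -addn1.
apply: (@spec_lt_trans _ (F (i + k.+1)%N)); first by apply: IH; lia.
by rewrite [(i + k.+2)%N]addnS; apply: hF; rewrite -addnS.
Qed.

Lemma prime_chain_link n (F : 'I_n.+1 -> Spec A) :
  prime_chain F -> link n (F ord0) (F ord_max).
Proof.
move=> hF; apply/rlinkP; exists (fun i => F (inord i)); split=> [||i ilt].
- by congr F; apply: val_inj; rewrite /= inordK.
- by congr F; apply: val_inj; rewrite /= inordK.
- by apply: hF; rewrite !inordK // ltnS // ltnW.
Qed.

(** The dimension of (A / I)_q. *)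
Definition rel_dim (I : set A) q d :=
  (exists2 P : Spec A, I `<=` P & link d P q) /\
  forall (P : Spec A) e, I `<=` P -> link e P q -> (e <= d)%N.

Lemma rel_dim_link I q d P Q e : rel_dim I q d ->
  I `<=` P -> (Q : set A) `<=` q -> link e P Q -> (e <= d)%N.
Proof.
move=> [_ hd] IP Qq lPQ; have [E|nE] := pselect (Q = q).
  by subst Q; exact: hd lPQ.
have := hd P (e + 1)%N IP (rlink_cat lPQ (link_gt0 Qq nE)).
by rewrite addn1; exact: ltnW.
Qed.

Lemma rel_dim_bounded I q N : I `<=` q ->
  (forall (P : Spec A) e, I `<=` P -> link e P q -> (e <= N)%N) ->
  exists d, rel_dim I q d.
Proof.
move=> Iq bN; pose S := [pred e | `[< exists2 P : Spec A, I `<=` P & link e P q >]].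
have S0 : exists e, S e by exists 0%N; apply/asboolP; exists q.
have SN e : S e -> (e <= N)%N by move=> /asboolP[P]; exact: bN.
case: (ex_maxnP S0 SN) => d /asboolP hd dmax; exists d; split=> // P e IP lP.
by apply: dmax; apply/asboolP; exists P.
Qed.

End PrimeChains.

(** Through [phi], [C] is the localization of [A / I] at [q]. *)
Definition fraction_map (A C : comPzRingType) (phi : {rmorphism A -> C})
    (I q : set A) :=
  [/\ forall c, exists a s, ~ q s /\ phi s * c = phi a,
      forall s, ~ q s -> exists b, phi s * b = 1 &
      forall a, phi a = 0 <-> sat q I a].

Lemma idealX1_sub (A : comPzRingType) (I : set A) :
  is_ideal I -> idealX I 1 `<=` I.
Proof.
by move=> hI; apply: ideal_gen_sub => // _ [x [y [_ Iy ->]]]; exact: idealM.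
Qed.

Lemma idealX2_mul (A : comPzRingType) (I : set A) x y :
  I x -> I y -> idealX I 2 (x * y).
Proof.
move=> Ix Iy; apply: sub_ideal_gen; exists x, y; split=> //.
by apply: sub_ideal_gen; exists 1, x; rewrite mul1r.
Qed.

Lemma idealX2_sub (A : comPzRingType) (I K : set A) : is_ideal I ->
  is_ideal K -> (forall x y, I x -> I y -> K (x * y)) -> idealX I 2 `<=` K.
Proof.
move=> hI hK IIK; apply: ideal_gen_sub => // _ [x [y [/(idealX1_sub hI) Ix Iy ->]]].
exact: IIK.
Qed.

Section FractionMap.
Variables (A C : comPzRingType) (phi : {rmorphism A -> C}).
Variables (I : set A) (q : Spec A).
Hypotheses (hI : is_ideal I) (Iq : I `<=` q) (hphi : fraction_map phi I q).

Let hq : is_ideal (q : set A) := prime_is_ideal q.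

Lemma frac_unit s : ~ prime_set q s -> exists b, phi s * b = 1.
Proof. by case: hphi => _ + _; apply. Qed.

Lemma frac_rep c : exists a s, ~ prime_set q s /\ phi s * c = phi a.
Proof. by case: hphi. Qed.

Lemma frac_eq0 a : phi a = 0 <-> sat q I a.
Proof. by case: hphi. Qed.

Lemma frac_memE (L : set C) c a s : is_ideal L -> ~ prime_set q s ->
  phi s * c = phi a -> L c <-> L (phi a).
Proof.
move=> hL qs e; rewrite -e; split=> [Lc|L1]; first exact: idealM.
have [b sb] := frac_unit qs.
by rewrite -(mul1r c) -sb mulrAC mulrC; exact: idealM.
Qed.

Lemma frac_nonunits a : nonunits C (phi a) <-> prime_set q a.
Proof.
split=> [h|qa [b ab]]; first by apply: contrapT => /frac_unit.
have [a' [s [qs sb]]] := frac_rep b.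
have : phi (a * a' - s) = 0.
  by rewrite rmorphB rmorphM -sb mulrCA ab mulr1 subrr.
move=> /frac_eq0[t qt /Iq h]; apply: (prime_notM (prime_setP q) qt qs).
have -> : t * s = t * a' * a - t * (a * a' - s) by ring.
by apply: idealB => //; exact: idealM.
Qed.

Lemma frac_nonunitsE c a s : ~ prime_set q s -> phi s * c = phi a ->
  nonunits C c <-> prime_set q a.
Proof.
move=> qs e; rewrite -frac_nonunits -e; have [b sb] := frac_unit qs.
split=> h [d]; last by move=> cd; apply: h; exists (b * d);
  rewrite mulrACA sb mul1r.
by move=> scd; apply: h; exists (phi s * d); rewrite mulrCA mulrA.
Qed.

Definition contract (L : set C) : set A := [set a | L (phi a)].

Lemma is_ideal_contract L : is_ideal L -> is_ideal (contract L).
Proof.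
move=> hL; split=> [|a b|a b]; rewrite /contract /=.
- by rewrite rmorph0; exact: ideal0.
- by rewrite rmorphD; exact: idealD.
- by rewrite rmorphM; exact: idealM.
Qed.

Definition extend (K : set A) : set C :=
  [set c | exists a s, [/\ ~ prime_set q s, K a & phi s * c = phi a]].

Lemma is_ideal_extend K : is_ideal K -> is_ideal (extend K).
Proof.
have qM := prime_notM (prime_setP q).
move=> hK; split=> [|c d|c d].
- exists 0, 1; rewrite mulr0 rmorph0; split=> //; last exact: ideal0.
  exact: prime_neq1 (prime_setP q).
- move=> [a [s [qs Ka e]]] [b [t [qt Kb f]]].
  exists (t * a + s * b), (s * t); split; [exact: qM|exact: is_idealL|].
  rewrite rmorphD !rmorphM -e -f; ring.
- have [a [s [qs e]]] := frac_rep c; move=> [b [t [qt Kb f]]].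
  exists (a * b), (s * t); split; [exact: qM|exact: idealM|].
  by rewrite !rmorphM mulrACA e f.
Qed.

Lemma contract_extend K : is_ideal K -> I `<=` K ->
  contract (extend K) = sat q K.
Proof.
move=> hK IK; apply/seteqP; split=> a; last first.
  by move=> [t qt Ka]; exists (t * a), t; rewrite rmorphM.
move=> [b [s [qs Kb e]]].
have : phi (s * a - b) = 0 by rewrite rmorphB rmorphM e subrr.
move=> /frac_eq0[t qt /IK h]; exists (t * s); first exact: prime_notM (prime_setP q) _ _.
have -> : t * s * a = t * (s * a - b) + t * b by ring.
by apply: idealD => //; exact: idealM.
Qed.

Lemma frac_is_ideal_nonunits : is_ideal (nonunits C).
Proof.
suff -> : nonunits C = extend q by exact: is_ideal_extend.
apply/seteqP; split=> c.
  by have [a [s [qs e]]] := frac_rep c; move/(frac_nonunitsE qs e); exists a, s.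
by move=> [a [s [qs qa e]]]; apply/(frac_nonunitsE qs e).
Qed.

Lemma frac_prime_nonunits : is_prime (nonunits C).
Proof.
split; first exact: frac_is_ideal_nonunits.
  by apply; exists 1; rewrite mulr1.
move=> c d; have [a [s [qs e]]] := frac_rep c; have [b [t [qt f]]] := frac_rep d.
have ef : phi (s * t) * (c * d) = phi (a * b).
  by rewrite !rmorphM mulrACA e f.
move/(frac_nonunitsE (prime_notM (prime_setP q) qs qt) ef).
case: (prime_setP q) => _ _ h /h[] ?; [left|right].
- exact/(frac_nonunitsE qs e).
- exact/(frac_nonunitsE qt f).
Qed.

Lemma frac_local : local_ring C.
Proof.
have proper (L : set C) : is_ideal L -> ~ L 1 -> L `<=` nonunits C.
  by move=> hL L1 c Lc [b cb]; apply: L1; rewrite -cb mulrC; exact: idealM.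
have [hN N1 _] := frac_prime_nonunits.
exists (nonunits C); split.
  split=> // L hL L1 NL; apply/seteqP; split=> //; exact: proper.
by move=> m [hm m1]; apply => //; exact: proper.
Qed.

Lemma frac_noetherian : noetherian A -> noetherian C.
Proof.
move=> nA L hL; have [s Ls] := noetherian_span nA (is_ideal_contract hL).
exists (map phi s); rewrite ideal_gen_seq.
have hsp := is_ideal_mspan (map phi s) (is_idealT C).
apply/seteqP; split; last first.
  apply: mspan_sub => // _ /mapP[a sa ->]; suff : contract L a by [].
  by rewrite Ls; exact: mspan_mem.
move=> c; have [a [t [qt e]]] := frac_rep c.
move/(frac_memE hL qt e) => La; apply/(frac_memE hsp qt e).
have : contract L a by [].
rewrite Ls; elim: (s) a {e La} => [|x r IH] a /=.
  by move=> ->; rewrite rmorph0.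
by move=> [b _ /IH h]; exists (phi b) => //; rewrite -rmorphM -rmorphB.
Qed.

Lemma is_prime_contract (P : Spec C) : is_prime (contract P).
Proof.
case: P => P [hP P1 PM] /=; split; first exact: is_ideal_contract.
- by rewrite /contract /= rmorph1.
- by move=> a b; rewrite /contract /= rmorphM => /PM.
Qed.

Definition comap (P : Spec C) : Spec A := MkSpec (is_prime_contract P).

Lemma comap_sub (P : Spec C) : (comap P : set A) `<=` q.
Proof.
move=> a Pa; apply: contrapT => /frac_unit[b ab].
apply: (prime_neq1 (prime_setP P)); rewrite -ab mulrC; apply: idealM => //.
exact: prime_is_ideal.
Qed.

Lemma comap_sup (P : Spec C) : I `<=` comap P.
Proof.
move=> a Ia /=; rewrite /contract /=; have -> : phi a = 0.
  by apply/frac_eq0; apply: sub_sat => //; exact: prime_setP.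
by apply: ideal0; exact: prime_is_ideal.
Qed.

Lemma comap_le (P Q : Spec C) :
  (comap P : set A) `<=` comap Q -> (P : set C) `<=` Q.
Proof.
move=> PQ c; have [a [s [qs e]]] := frac_rep c.
move/(frac_memE (prime_is_ideal P) qs e)/PQ => h.
exact/(frac_memE (prime_is_ideal Q) qs e).
Qed.

Lemma comap_lt (P Q : Spec C) : spec_lt P Q <-> spec_lt (comap P) (comap Q).
Proof.
split=> -[PQ nQP]; split.
- by move=> a; exact: PQ.
- by move=> /comap_le.
- exact: comap_le.
- by move=> QP; apply: nQP => a; exact: QP.
Qed.

(** With [comap_lt] this identifies Spec C, as an ordered set, with the primes between I and q, so
    that chains of primes of C can be measured in A. *)
Lemma comap_onto (P : Spec A) : I `<=` P -> (P : set A) `<=` q ->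
  exists P', comap P' = P.
Proof.
move=> IP Pq; have hP := prime_is_ideal P.
have contrE : contract (extend P) = P.
  rewrite contract_extend //; apply/seteqP; split.
    exact: sat_prime (prime_setP P) Pq.
  by apply: sub_sat; exact: prime_setP.
have pP : is_prime (extend P).
  have hE := is_ideal_extend hP; split=> //.
    suff : ~ contract (extend P) 1 by rewrite /contract /= rmorph1.
    by rewrite contrE; exact: prime_neq1 (prime_setP P).
  move=> c d; have [a [s [qs e]]] := frac_rep c; have [b [t [qt f]]] := frac_rep d.
  have ef : phi (s * t) * (c * d) = phi (a * b).
    by rewrite !rmorphM mulrACA e f.
  move/(frac_memE hE (prime_notM (prime_setP q) qs qt) ef).
  rewrite -[extend P _]/(contract (extend P) (a * b)) contrE.
  case: (prime_setP P) => _ _ h /h[Pa|Pb]; [left|right].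
  - apply/(frac_memE hE qs e); rewrite -[extend P _]/(contract (extend P) a).
    by rewrite contrE.
  - apply/(frac_memE hE qt f); rewrite -[extend P _]/(contract (extend P) b).
    by rewrite contrE.
by exists (MkSpec pP); apply: spec_eq.
Qed.

Lemma comap_link n (P Q : Spec C) : link n P Q -> link n (comap P) (comap Q).
Proof.
elim: n P => [|n IH] P /=; first by move=> ->.
by move=> [R /comap_lt PR /IH RQ]; exists (comap R).
Qed.

Lemma link_comap n (P : Spec C) (Q : Spec A) : (Q : set A) `<=` q ->
  link n (comap P) Q -> exists2 Q', comap Q' = Q & link n P Q'.
Proof.
move=> Qq; elim: n P => [|n IH] P /=; first by move=> <-; exists P.
move=> [R PR RQ]; have [R' RE] : exists R', comap R' = R.
  apply: comap_onto; first by apply: subset_trans PR.1; exact: comap_sup.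
  exact: subset_trans (link_sub RQ) Qq.
subst R; have [Q' QE lQ'] := IH _ RQ; exists Q' => //; exists R' => //.
exact/comap_lt.
Qed.

Lemma frac_krull_dim d : rel_dim I q d -> krull_dim C = d.
Proof.
move=> hd; rewrite /krull_dim; have [[P IP lP] _] := hd.
have isd : is_krull_dim C d.
  split=> [|e F /prime_chain_link/comap_link].
    have [P' PE] := comap_onto IP (link_sub lP).
    rewrite -PE in lP; have [q' _ /rlinkP[F [_ _ hF]]] := link_comap (@subset_refl _ _) lP.
    by exists (fun i : 'I_d.+1 => F i); exact: prime_chain_nat.
  exact: (rel_dim_link hd (@comap_sup _) (@comap_sub _)).
apply: xget_unique => // e [[F hF] emax].
by apply/eqP; rewrite eqn_leq (isd.2 _ _ hF); case: isd => -[G /emax].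
Qed.

End FractionMap.

(** * Linear algebra over the residue field of a prime *)

Section Combinations.
Variable A : comPzRingType.
Implicit Types (Q q I J : set A).

Lemma mspan_ord Q n (x : 'I_n -> A) z : mspan Q [seq x i | i <- enum 'I_n] z <->
  exists2 a : 'I_n -> A, forall i, Q (a i) & z = \sum_i a i * x i.
Proof.
elim: n x z => [|n IH] x z.
  rewrite (size0nil (size_enum_ord 0)) /=; split=> [->|[a _ ->]].
    by exists (fun=> 0); [case=> m im|rewrite big_ord0].
  by rewrite big_ord0.
rewrite enum_ordSl /= -map_comp; split=> [[b Qb]|[a Qa ->]].
  move=> /IH[a Qa e]; exists (fun i => oapp a b (unlift ord0 i)).
    by move=> i; case: unliftP => [j _|_] /=; [exact: Qa|exact: Qb].
  rewrite big_ord_recl unlift_none /= -(subrK (b * x ord0) z) e addrC.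
  by congr (_ + _); apply: eq_bigr => i _; rewrite liftK.
exists (a ord0) => //; apply/IH; exists (a \o lift ord0) => [i|]; first exact: Qa.
by rewrite big_ord_recl addrC addKr.
Qed.

Lemma mul_comb n (t : A) (a x : 'I_n -> A) :
  t * (\sum_i a i * x i) = \sum_i (t * a i) * x i.
Proof. by rewrite mulr_sumr; apply: eq_bigr => i _; rewrite mulrA. Qed.

Lemma sub_comb n (a b x : 'I_n -> A) :
  \sum_i a i * x i - \sum_i b i * x i = \sum_i (a i - b i) * x i.
Proof. by rewrite -sumrB; apply: eq_bigr => i _; rewrite mulrBl. Qed.

(** Linear dependence of more than k vectors in a k-dimensional space over kappa(q), with
    coefficients in A: Gaussian elimination by cross-multiplication with a pivot outside q. The
    coefficient at the pivot row is chosen to cancel the first coordinate. *)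
Lemma prime_dependent q k n (a : 'I_n -> 'I_k -> A) : is_prime q -> (k < n)%N ->
  exists2 c : 'I_n -> A, exists i, ~ q (c i) &
    forall j, q (\sum_i c i * a i j).
Proof.
move=> pq; have hq := prime_ideal pq.
elim: k n a => [|k IH] [//|n] a kn.
  by exists (fun=> 1); [exists ord0; exact: prime_neq1|case=> m im].
have [a0|/existsNP[i0 nqa]] := pselect (forall i, q (a i ord0)).
  have [c c0 hc] := IH n.+1 (fun i j => a i (lift ord0 j)) (ltnW kn).
  exists c => // j; case: (unliftP ord0 j) => [j' ->|->]; first exact: hc.
  by apply: ideal_sum => // i; exact: idealM.
pose a' i j := a i0 ord0 * a (lift i0 i) (lift ord0 j) -
  a (lift i0 i) ord0 * a i0 (lift ord0 j).
have [c [i1 ci1] hc] := IH n a' kn.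
pose c' i := if unlift i0 i is Some i' then a i0 ord0 * c i'
  else - \sum_i c i * a (lift i0 i) ord0.
have sumE j : \sum_i c' i * a i j = \sum_i c i *
    (a i0 ord0 * a (lift i0 i) j - a (lift i0 i) ord0 * a i0 j).
  rewrite (bigD1_ord i0) //= {1}/c' unlift_none mulNr mulr_suml addrC -sumrB.
  by apply: eq_bigr => i _; rewrite /c' liftK; ring.
exists c'; first by exists (lift i0 i1); rewrite /c' liftK; exact: prime_notM.
move=> j; rewrite sumE; case: (unliftP ord0 j) => [j' ->|->]; first exact: hc.
by rewrite big1 => [|i _]; [exact: ideal0|ring].
Qed.

(** If m > n, a dependence modulo q between the coordinates of the [x i] in terms of [y] would put a
    combination of the [x i] with a coefficient outside q into q^2. *)
Lemma cotangent_rank q m n (x : 'I_m -> A) (y : 'I_n -> A) : is_prime q ->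
  cotangent_basis q x -> cotangent_basis q y -> (m <= n)%N.
Proof.
move=> pq [qx _ indx] [qy spany _]; rewrite leqNgt; apply/negP => nm.
have h i : exists b : 'I_n -> A, idealX q 2 (x i - \sum_j b j * y j).
  exact: spany.
pose b i := sval (cid (h i)).
have [c [i0 nqc] hc] := prime_dependent b pq nm.
apply: nqc; apply: (indx c _ i0).
have -> : \sum_i c i * x i = \sum_i c i * (x i - \sum_j b i j * y j) +
    \sum_j (\sum_i c i * b i j) * y j.
  rewrite (eq_bigr (fun j => \sum_i c i * (b i j * y j))); last first.
    by move=> j _; rewrite mulr_suml; apply: eq_bigr => i _; rewrite mulrA.
  rewrite exchange_big -big_split; apply: eq_bigr => i _ /=.
  by rewrite -mulr_sumr -mulrDr subrK.
have hX := is_idealX q 2.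
apply: (idealD hX); apply: (ideal_sum _ hX).
  by move=> i; apply: (idealM _ hX); rewrite /b; case: (cid _).
by move=> j; exact: idealX2_mul.
Qed.

Lemma edimE q n (x : 'I_n -> A) : nonunits A = q -> is_prime q ->
  cotangent_basis q x -> edim A = n.
Proof.
move=> NE pq bx; apply: xget_unique; first by exists x; rewrite NE.
move=> m [y]; rewrite NE => bY.
by apply/eqP; rewrite eqn_leq (cotangent_rank pq bY bx) (cotangent_rank pq bx bY).
Qed.

(** [x] is a basis of the cotangent space of (A / I)_q. *)
Definition rel_basis (I q : set A) n (x : 'I_n -> A) :=
  [/\ forall i, q (x i),
      forall y, q y -> exists t (a : 'I_n -> A),
        ~ q t /\ addi (idealX q 2) I (t * y - \sum_i a i * x i) &
      forall a : 'I_n -> A,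
        sat q (addi (idealX q 2) I) (\sum_i a i * x i) -> forall i, q (a i)].

(** A finite generating family of q is thinned out: a relation whose coefficient at [x k] is outside
    q allows [x k] to be eliminated after enlarging the denominator. *)
Lemma rel_basis_exists I q : noetherian A -> is_prime q -> is_ideal I ->
  exists n (x : 'I_n -> A), rel_basis I q x.
Proof.
move=> nA pq hI; have hq := prime_ideal pq.
have hJ := is_ideal_addi (is_idealX q 2) hI; set J := addi _ _ in hJ *.
suff red n (x : 'I_n -> A) : (forall i, q (x i)) ->
    (forall y, q y -> exists t (a : 'I_n -> A),
      ~ q t /\ J (t * y - \sum_i a i * x i)) ->
    exists m (z : 'I_m -> A), rel_basis I q z.
  have [s qs] := noetherian_span nA hq.
  apply: (red _ (tnth (in_tuple s))) => [i|y].
    by rewrite qs; apply: mspan_mem; exact: mem_tnth.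
  rewrite qs -{1}[s]/(tval (in_tuple s)) -{1}(map_tnth_enum (in_tuple s)).
  move=> /mspan_ord[a _ ->]; exists 1, a; split; first by rewrite -qs; exact: prime_neq1.
  by rewrite mul1r subrr; exact: ideal0.
elim: n x => [|n IH] x qx spanx.
  by exists 0%N, x; split=> // a _ [m im].
have [ind|/existsNP[a /not_implyP[[s qs Ja] /existsNP[k qak]]]] := pselect
  (forall a : 'I_n.+1 -> A, sat q J (\sum_i a i * x i) -> forall i, q (a i)).
  by exists n.+1, x.
apply: (IH (x \o lift k)) => [i|y /spanx[t [b [qt Jb]]]]; first exact: qx.
exists (s * a k * t), (fun i => s * (a k * b (lift k i) - b k * a (lift k i))).
split; first by do 2 ?apply: prime_notM.
rewrite (bigD1_ord k) //= in Ja; rewrite (bigD1_ord k) //= in Jb.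
have -> : s * a k * t * y -
    \sum_i s * (a k * b (lift k i) - b k * a (lift k i)) * x (lift k i) =
  s * a k * (t * y - (b k * x k + \sum_i b (lift k i) * x (lift k i))) +
  b k * (s * (a k * x k + \sum_i a (lift k i) * x (lift k i))).
  have -> : \sum_i s * (a k * b (lift k i) - b k * a (lift k i)) * x (lift k i) =
      s * a k * (\sum_i b (lift k i) * x (lift k i)) -
      s * b k * (\sum_i a (lift k i) * x (lift k i)).
    rewrite !mulr_sumr -sumrB; apply: eq_bigr => i _; ring.
  ring.
exact: is_idealL.
Qed.

End Combinations.

Section FractionEdim.
Variables (A C : comPzRingType) (phi : {rmorphism A -> C}).
Variables (I : set A) (q : Spec A).
Hypotheses (hI : is_ideal I) (Iq : I `<=` q) (hphi : fraction_map phi I q).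

(** The bridge between m / m^2 in C and [rel_basis], which is phrased in A. *)
Lemma contract_nonunits2 :
  contract phi (idealX (nonunits C) 2) = sat q (addi (idealX q 2) I).
Proof.
have hX := is_idealX (q : set A) 2; have hN := frac_is_ideal_nonunits Iq hphi.
have hJ := is_ideal_addi hX hI.
apply/seteqP; split=> a.
  rewrite -(contract_extend hphi hJ); last exact: (addir hX).
  apply: idealX2_sub; [done|exact: (is_ideal_extend hphi hJ)|].
  move=> c d; have [b [s [qs e]]] := frac_rep hphi c.
  have [b' [t [qt f]]] := frac_rep hphi d.
  move=> /(frac_nonunitsE Iq hphi qs e) qb /(frac_nonunitsE Iq hphi qt f) qb'.
  exists (b * b'), (s * t); split.
  - exact: prime_notM (prime_setP q) _ _.
  - by apply: addil => //; exact: idealX2_mul.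
  - by rewrite !rmorphM mulrACA e f.
have hcX := is_ideal_contract phi (is_idealX (nonunits C) 2).
move=> [t qt Jta].
apply/(frac_memE hphi (is_idealX _ 2) qt (esym (rmorphM _ _ _))).
apply: (addi_sub hcX _ _ Jta); last first.
  move=> z Iz; rewrite /contract /=; have -> : phi z = 0.
    by apply/(frac_eq0 hphi); apply: sub_sat => //; exact: prime_setP.
  exact: (ideal0 (is_idealX (nonunits C) 2)).
apply: idealX2_sub => //; first exact: prime_is_ideal.
move=> x y qx qy; rewrite /contract /= rmorphM; apply: idealX2_mul.
- exact: (frac_nonunits Iq hphi _).2.
- exact: (frac_nonunits Iq hphi _).2.
Qed.

Lemma common_denominator n (c : 'I_n -> C) :
  exists s (a : 'I_n -> A), ~ prime_set q s /\ forall i, phi s * c i = phi (a i).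
Proof.
elim: n c => [|n IH] c.
  exists 1, (fun=> 0); split=> [|[m im] //].
  exact: prime_neq1 (prime_setP q).
have [s [a [qs h]]] := IH (c \o lift ord0).
have [b [t [qt e]]] := frac_rep hphi (c ord0).
exists (s * t), (fun i => oapp (fun j => t * a j) (s * b) (unlift ord0 i)).
split; first exact: prime_notM (prime_setP q) _ _.
move=> i; case: unliftP => [j ->|->] /=.
  by rewrite !rmorphM -h /=; ring.
by rewrite !rmorphM -e mulrA.
Qed.

Lemma frac_edim n (x : 'I_n -> A) : rel_basis I q x -> edim C = n.
Proof.
move=> [qx spanx indx].
have memX z : idealX (nonunits C) 2 (phi z) <-> sat q (addi (idealX q 2) I) z.
  by rewrite -contract_nonunits2.
have phi_comb (a : 'I_n -> A) :
    phi (\sum_i a i * x i) = \sum_i phi (a i) * phi (x i).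
  by rewrite rmorph_sum; apply: eq_bigr => i _; rewrite rmorphM.
apply: (edimE (q := nonunits C) (x := phi \o x)) => //.
  exact: (frac_prime_nonunits Iq hphi).
split=> [i|c|c] /=; first exact: (frac_nonunits Iq hphi _).2.
- have [y [s [qs e]]] := frac_rep hphi c.
  move=> /(frac_nonunitsE Iq hphi qs e) /spanx[t [a [qt Ja]]].
  have [b tsb] := frac_unit hphi (prime_notM (prime_setP q) qt qs).
  exists (fun i => b * phi (a i)).
  have -> : c - \sum_i b * phi (a i) * phi (x i) =
      b * phi (t * y - \sum_i a i * x i).
    rewrite rmorphB phi_comb rmorphM -e mulrBr -mul_comb; congr (_ - _).
    by rewrite -[LHS]mul1r -tsb rmorphM; ring.
  apply: (idealM _ (is_idealX (nonunits C) 2)).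
  by apply/memX; apply: sub_sat => //; exact: prime_setP.
- have [s [a [qs h]]] := common_denominator c => Xc i.
  apply/(frac_nonunitsE Iq hphi qs (h i)); apply: (indx a _ i); apply/memX.
  rewrite phi_comb (eq_bigr (fun k => phi s * c k * phi (x k))); last first.
    by move=> k _; rewrite h.
  by rewrite -mul_comb; exact: (idealM _ (is_idealX (nonunits C) 2)).
Qed.

End FractionEdim.

(** * Constancy of the defect near a generic point *)

Section GenericDimension.
Variable A : comPzRingType.
Implicit Types (P Q R q : Spec A).

Definition covers P Q := spec_lt P Q /\
  forall R, ~ (spec_lt P R /\ spec_lt R Q).

(** A prime inserted between two neighbours would lengthen the chain. *)
Lemma longest_link_saturated n P Q : link n P Q ->
  (forall m, link m P Q -> (m <= n)%N) -> rlink covers n P Q.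
Proof.
elim: n P => [//|n IH] P [R PR RQ] nmax; exists R.
  split=> // S [PS SR].
  have : link n.+2 P Q by exists S => //; exists R.
  by move=> /nmax; rewrite ltnn.
by apply: IH => // m mRQ; rewrite -ltnS; apply: nmax; exists R.
Qed.

Lemma catenary_saturated m n P Q : catenary A ->
  rlink covers m P Q -> rlink covers n P Q -> m = n.
Proof.
move=> cA; have sat k : rlink covers k P Q -> exists F : 'I_k.+1 -> Spec A,
    [/\ saturated_chain F, F ord0 = P & F ord_max = Q].
  move=> /rlinkP[F [F0 Fk hF]]; exists (fun i : 'I_k.+1 => F i); split=> //.
  split=> [|i j r ij]; first by apply: prime_chain_nat => i /hF[].
  by rewrite ij; apply: (hF i _).2; rewrite -ltnS -ij.
have lPQ k : rlink covers k P Q -> (P : set A) `<=` Q.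
  elim: k P {sat} => [P -> //|k IH P [R [[PR _] _] /IH]].
  exact: subset_trans.
move=> hm hn; have [F [sF F0 FQ]] := sat _ hm; have [G [sG G0 GQ]] := sat _ hn.
exact: (cA P Q (lPQ _ hm)).2 sF F0 FQ sG G0 GQ.
Qed.

Lemma rel_dim_exists (I : set A) q : noetherian A -> is_ideal I -> I `<=` q ->
  exists d, rel_dim I q d.
Proof.
move=> nA hI Iq; have [s qs] := noetherian_span nA (prime_is_ideal q).
apply: (@rel_dim_bounded _ _ _ (size s)) => // P e.
apply: height_le => // [x xs|a qa]; first by rewrite qs; exact: mspan_mem.
apply: sub_sat; first exact: prime_setP.
by apply: addil => //; rewrite -qs.
Qed.

(** A longest chain starts at P itself, for one that starts strictly above P could be prolonged
    downwards. *)
Lemma rel_dim_start P q d : rel_dim P q d -> link d P q.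
Proof.
move=> [[R PR lR] dmax]; have [->//|nPR] := pselect (P = R).
have := dmax P (1 + d)%N (@subset_refl _ _) (rlink_cat (link_gt0 PR nPR) lR).
by rewrite add1n ltnn.
Qed.

(** If a b lies in K, every prime above K is above K + (a) or K + (b), and both are strictly larger
    when neither a nor b is in K. The list may contain primes that are not minimal. *)
Lemma finitely_many_minimal_primes : noetherian A ->
  exists s : seq (Spec A), forall P, exists2 R, R \in s & (R : set A) `<=` P.
Proof.
move=> nA; suff h K : is_ideal K -> exists s : seq (Spec A), forall P,
    K `<=` P -> exists2 R, R \in s & (R : set A) `<=` P.
  have [s hs] := h _ (is_ideal0 A); exists s => P; apply: hs => _ ->.
  exact: ideal0 (prime_is_ideal P).
move: K; apply: noetherian_ind => // K hK IH.
have [pK|npK] := pselect (is_prime K).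
  by exists [:: MkSpec pK] => P KP; exists (MkSpec pK); rewrite ?mem_head.
have [K1|nK1] := pselect (K 1).
  by exists [::] => P KP; case: (prime_neq1 (prime_setP P)); exact: KP.
have [a [b [Kab nKa nKb]]] := not_prime_factors hK nK1 npK.
have bigger c : ~ K c -> exists s : seq (Spec A), forall P,
    adjoin K c `<=` P -> exists2 R, R \in s & (R : set A) `<=` P.
  move=> nKc; apply: IH; first exact: is_ideal_adjoin.
  by split; [exact: sub_adjoin|move=> /(_ c (adjoin_mem c hK))].
have [s hs] := bigger a nKa; have [t ht] := bigger b nKb.
exists (s ++ t) => P KP; have hP := prime_is_ideal P.
case: (prime_setP P) => _ _ /(_ a b (KP _ Kab))[Pc|Pc].
- have [R Rs RP] := hs P (adjoin_sub hP KP Pc).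
  by exists R => //; rewrite mem_cat Rs.
- have [R Rs RP] := ht P (adjoin_sub hP KP Pc).
  by exists R => //; rewrite mem_cat Rs orbT.
Qed.

(** Near the generic point p of V(p) all minimal primes are below p, and
    catenarity makes the height additive along p. *)
Lemma generic_dim P : noetherian A -> catenary A ->
  exists2 f, ~ prime_set P f & forall q h d, (P : set A) `<=` q ->
    ~ prime_set q f -> rel_dim [set 0] P h -> rel_dim P q d ->
    rel_dim [set 0] q (h + d).
Proof.
move=> nA cA; have [s hs] := finitely_many_minimal_primes nA.
(* A product of elements outside P, one from each listed prime not below P; hence a listed prime
   below some q that avoids f is below P. *)
have [f nPf hf] : exists2 f, ~ prime_set P f &
    forall R, R \in s -> ~ ((R : set A) `<=` P) -> prime_set R f.
  elim: s {hs} => [|R s [f nPf hf]].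
    by exists 1 => //; exact: prime_neq1 (prime_setP P).
  have [RP|/existsNP[g /not_implyP[Rg nPg]]] := pselect ((R : set A) `<=` P).
    exists f => // S; rewrite inE => /orP[/eqP->//|]; exact: hf.
  exists (f * g); first exact: prime_notM (prime_setP P) _ _.
  move=> S; rewrite inE => /orP[/eqP-> _|Ss nSP].
    by apply: idealM => //; exact: prime_is_ideal.
  by rewrite mulrC; apply: idealM; [exact: prime_is_ideal|exact: hf].
exists f => // q h d Pq nqf hh hd; split.
  have [[R R0 lR] _] := hh; exists R => //.
  by apply: rlink_cat lR _; exact: rel_dim_start.
move=> S e _ lS; have [R Rs RS] := hs S.
have RP : (R : set A) `<=` P.
  apply: contrapT => nRP; apply: nqf.
  by apply: (link_sub lS); apply: RS; exact: hf.
have R0 : [set 0] `<=` (R : set A) by move=> _ ->; exact: ideal0 (prime_is_ideal R).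
have [a ha] := rel_dim_exists nA (prime_is_ideal R) RP.
have [b hb] := rel_dim_exists nA (prime_is_ideal R) (subset_trans RP Pq).
have satE T U k : rel_dim (T : Spec A) U k -> rlink covers k T U.
  move=> hk; apply: longest_link_saturated; first exact: rel_dim_start.
  by move=> m lm; apply: hk.2 lm.
(* Longest chains from R to P and from P to q concatenate to a saturated chain from R to q, which
   catenarity compares with a longest one. *)
have bE : b = (a + d)%N.
  apply: (@catenary_saturated _ _ R q cA (satE _ _ _ hb)).
  exact: rlink_cat (satE _ _ _ ha) (satE _ _ _ hd).
apply: leq_trans (hb.2 _ _ RS lS) _; rewrite bE leq_add2r.
exact: hh.2 R0 (rel_dim_start ha).
Qed.

(** Above p, the elements [y] generate p / p^2 as long as f does not vanish;
    by [regular_sequence] they stay independent in the cotangent space at q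
    when (A / p)_q is regular. *)
Lemma rel_basis_cat P q d e (x : 'I_d -> A) (y : 'I_e -> A) f :
  noetherian A -> (P : set A) `<=` q -> link d P q ->
  rel_basis P q x -> rel_basis [set 0] P y -> ~ prime_set q f ->
  (forall z, prime_set P z ->
     addi (lspan [seq y j | j <- enum 'I_e]) (idealX P 2) (f * z)) ->
  rel_basis [set 0] q
    (fun i : 'I_(d + e) => match split i with inl j => x j | inr j => y j end).
Proof.
move=> nA Pq lPq [qx spanx indx] [Py _ indy] nqf hf.
set xy := (fun i : 'I_(d + e) => _).
have xyl j : xy (lshift e j) = x j.
  by rewrite /xy; case: split_ordP => k /(congr1 val) /= E;
    [congr x; exact: val_inj|have := ltn_ord j; rewrite E; lia].
have xyr j : xy (rshift d j) = y j.
  by rewrite /xy; case: split_ordP => k /(congr1 val) /= E;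
    [have := ltn_ord k; rewrite -E; lia|congr y; apply: val_inj => /=; lia].
have pq := prime_setP q; have hq := prime_is_ideal q; have hP := prime_is_ideal P.
have hX := is_idealX (q : set A) 2; have hXP := is_idealX (P : set A) 2.
have XPq : idealX P 2 `<=` idealX q 2.
  by apply: idealX2_sub => // a b /Pq qa /Pq qb; exact: idealX2_mul.
have XqP : idealX P 2 `<=` P by apply: idealX2_sub => // a b _; exact: idealM.
pose xs := [seq x j | j <- enum 'I_d]; pose ys := [seq y j | j <- enum 'I_e].
have xsq a : a \in xs -> prime_set q a by move=> /mapP[j _ ->].
have ysP a : a \in ys -> prime_set P a by move=> /mapP[j _ ->].
(* At q this ideal is q P, because [ys] generates P modulo P^2 where f is invertible; this form
   displays coefficients in q. *)
pose K := addi (mspan q ys) (idealX P 2).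
have hys := is_ideal_mspan ys hq; have hK : is_ideal K by exact: is_ideal_addi.
have hsK := is_ideal_sat pq hK.
have KP : K `<=` P.
  apply: addi_sub => //; apply: subset_trans (mspan_mono (@subsetT _ _)) _.
  exact: mspan_sub.
have PqK a b : prime_set P a -> prime_set q b -> sat q K (b * a).
  move=> /hf[w sw Xfa] qb; exists f => //.
  have -> : f * (b * a) = b * w + b * (f * a - w) by ring.
  apply: idealD => //; first by apply: addil => //; exact: mspan_scale.
  by apply: (addir hys); exact: (idealM _ hXP).
have hspx : is_ideal (lspan xs) by exact: is_ideal_mspan.
have qxs : (q : set A) `<=` sat q (addi (lspan xs) P).
  have [s qs] := noetherian_span nA hq.
  have hJ := is_ideal_addi hspx hP; have hqs := is_ideal_mspan s hq.
  (* [xs] generates q modulo q^2 + P, hence modulo P at q by Nakayama's lemma. *)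
  have [t qt tJ] : exists2 t, ~ prime_set q t &
      forall a, lspan s a -> addi (lspan xs) P (t * a).
    apply: local_nakayama => // a; rewrite -qs => /spanx[t [b [qt [u Xu Pv]]]].
    exists t => //; exists u.
      apply: (idealX2_sub hq hqs _ Xu) => c c' qc qc'; apply: mspan_scale => //.
      by rewrite -qs.
    exists (\sum_i b i * x i); first by apply/mspan_ord; exists b.
    by move: Pv; congr (prime_set P _); ring.
  by move=> a; rewrite {1}qs => /tJ; exists t.
have [_ regx] : (P : set A) `<=` sat q P /\ (lspan xs `&` P `<=` sat q (mspan P xs)).
  apply: (regular_sequence nA hP xsq qxs (@subset_refl _ _)).
  by rewrite size_map size_enum_ord.
have regK z : lspan xs z -> prime_set P z -> sat q K z.
  move=> xz Pz; apply: sat_sat => //.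
  apply: (sat_mono _ (regx _ (conj xz Pz))).
  by apply: mspan_le => // a b Pa /xsq qb; rewrite mulrC; exact: PqK.
have X2 : idealX q 2 `<=` sat q (addi (lspan xs) (sat q K)).
  have hJ := is_ideal_addi hspx hsK.
  apply: idealX2_sub => //; first exact: is_ideal_sat.
  move=> a b /qxs[t qt [u xu Pv]] qb; exists t => //; exists (b * u).
    exact: idealM.
  have -> : t * (a * b) - b * u = b * (t * a - u) by ring.
  exact: PqK.
(* At q, an element of P ∩ q^2 is the sum of an element of (x) and one of K. As K is contained in P,
   the first summand lies in (x) ∩ P, where [regK] applies. *)
have PX2 z : prime_set P z -> sat q (idealX q 2) z -> sat q K z.
  move=> Pz [t qt /X2[s qs [w xw Kv]]].
  have Pv : prime_set P (s * (t * z) - w).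
    by apply: (sat_prime (prime_setP P) Pq); exact: (sat_mono KP Kv).
  have Pw : prime_set P w.
    have -> : w = s * (t * z) - (s * (t * z) - w) by ring.
    by apply: idealB => //; do 2 apply: idealM => //.
  have qst := prime_notM pq qs qt.
  apply: (sat_scale pq qst); have -> : s * t * z = w + (s * (t * z) - w) by ring.
  by apply: idealD => //; exact: regK.
have sumxy (a : 'I_(d + e) -> A) : \sum_i a i * xy i =
    \sum_j a (lshift e j) * x j + \sum_j a (rshift d j) * y j.
  rewrite big_split_ord /=; congr (_ + _); apply: eq_bigr => j _.
  - by rewrite xyl.
  - by rewrite xyr.
rewrite /rel_basis addi0; split=> [i|w /spanx[t [a [qt [u Xu Pv]]]]|a].
- by rewrite /xy; case: (split i) => j //; exact: Pq.
- have [w' /mspan_ord[c _ ->] Xr] := hf _ Pv.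
  exists (f * t), (fun i => match split i with inl j => f * a j | inr j => c j end).
  split; first exact: prime_notM.
  rewrite sumxy.
  rewrite (eq_bigr (fun j => f * a j * x j)); last first.
    move=> j _; case: split_ordP => k /(congr1 val) /= E.
      by have -> : k = j by apply: val_inj.
    by have := ltn_ord j; rewrite E; lia.
  rewrite -mul_comb.
  rewrite (eq_bigr (fun j => c j * y j)); last first.
    move=> j _; case: split_ordP => k /(congr1 val) /= E.
      by have := ltn_ord k; rewrite -E; lia.
    by have -> : k = j by apply: val_inj => /=; lia.
  move: Xr; set sx := \sum_j a j * x j; set sy := \sum_j c j * y j => Xr.
  have -> : f * t * w - (f * sx + sy) = f * u + (f * (t * w - sx - u) - sy) by ring.
  by apply: (idealD hX); [exact: (idealM _ hX)|exact: XPq].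
- rewrite sumxy; set X := \sum_j _ * x j; set Y := \sum_j _ * y j.
  move=> [t qt XY]; have PY : prime_set P Y.
    by apply: ideal_sum => // j; exact: idealM.
  (* Modulo P the part [Y] disappears, and independence of [x] at q modulo P applies. *)
  have qal : forall j, prime_set q (a (lshift e j)).
    apply: indx; rewrite -/X; exists t => //; exists (t * (X + Y)) => //.
    have -> : t * X - t * (X + Y) = - (t * Y) by ring.
    by apply: is_idealN => //; exact: idealM.
  have XX : idealX q 2 X.
    by apply: (ideal_sum _ hX) => j; exact: idealX2_mul.
  have [s qs [w /mspan_ord[c qc ->] Xw]] : sat q K Y.
    apply: PX2 => //; exists t => //.
    have -> : t * Y = t * (X + Y) - t * X by ring.
    by apply: (idealB hX) => //; exact: (idealM _ hX).
  (* Now s Y agrees modulo P^2 with a combination of [y] with coefficients [c] in q. Independence of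
     [y] at P puts each s a - c in P, hence in q. *)
  have qar j : prime_set q (a (rshift d j)).
    apply: (prime_cancel pq qs).
    rewrite -(subrK (c j) (s * _)); apply: idealD => //; apply: Pq.
    move: j; apply: indy; apply: sub_sat; first exact: prime_setP.
    by rewrite addi0 -sub_comb -mul_comb.
  by move=> i; rewrite -[i]splitK; case: (split i).
Qed.

End GenericDimension.

(** * Localizations and quotients as instances of [fraction_map] *)

Lemma localization_fraction (A : comPzRingType) (q : Spec A) :
  fraction_map (loc_map q) [set 0] q.
Proof.
split=> [c|s nqs|a].
- rewrite -(qreprK c); case: (qrepr c) => a [s nqs]; exists a, s; split=> //.
  rewrite /= -qclsM; apply/qclsP; apply: (frac_eqv_eq (is_ideal0 A) (prime_compl_multiplicative q)).
  by rewrite /=; ring.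
- exists (loc_frac 1 nqs); rewrite /= -qclsM; apply/qclsP.
  apply: (frac_eqv_eq (is_ideal0 A) (prime_compl_multiplicative q)).
  by rewrite /=; ring.
- rewrite -(rmorph0 (loc_map q)); split=> [/qclsP[u nqu /= h]|[u nqu h]].
    by exists u => //; move: h; rewrite !mulr1 subr0.
  by apply/qclsP; exists u; rewrite //= !mulr1 subr0.
Qed.

Section Quotient.
Variables (A B : comPzRingType) (pi : {rmorphism A -> B}) (I : set A).
Hypotheses (pi_onto : forall b, exists a, pi a = b)
  (pi_ker : forall a, pi a = 0 <-> I a).

Lemma quotient_fraction (q : Spec B) :
  fraction_map (loc_map q \o pi : {rmorphism A -> localization q}) I
    (contract pi q).
Proof.
have [rep unit eq0] := localization_fraction q.
split=> [c|s nqs|a] /=.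
- have [b [t [nqt e]]] := rep c; have [a aE] := pi_onto b.
  by have [s sE] := pi_onto t; exists a, s; rewrite /contract /= sE aE.
- exact: unit.
- rewrite eq0; split=> -[t nqt].
    by have [s sE] := pi_onto t; subst t; rewrite -rmorphM /= => /pi_ker; exists s.
  by move=> /pi_ker h; exists (pi t) => //; rewrite -rmorphM.
Qed.

Lemma quotient_prime (q : Spec A) : I `<=` q ->
  exists q' : Spec B, contract pi q' = q.
Proof.
move=> Iq; pose L : set B := [set b | exists2 a, prime_set q a & pi a = b].
have Lpi a : L (pi a) <-> prime_set q a.
  split=> [[a' qa' /eqP]|]; last by exists a.
  rewrite -subr_eq0 -rmorphB => /eqP/pi_ker/Iq qd.
  have -> : a = a' - (a' - a) by ring.
  by apply: idealB => //; exact: prime_is_ideal.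
have pL : is_prime L.
  split; last first.
  - move=> b c; have [a <-] := pi_onto b; have [a' <-] := pi_onto c.
    by rewrite -rmorphM !Lpi; case: (prime_setP q) => _ _; apply.
  - by rewrite -(rmorph1 pi) Lpi; exact: prime_neq1 (prime_setP q).
  have hq := prime_is_ideal q; split.
  - by exists 0; rewrite ?rmorph0 //; exact: ideal0.
  - move=> _ _ [a qa <-] [b qb <-]; exists (a + b); rewrite ?rmorphD //.
    exact: idealD.
  - move=> b _ [a qa <-]; have [c <-] := pi_onto b.
    by exists (c * a); rewrite ?rmorphM //; exact: idealM.
exists (MkSpec pL); apply/seteqP; split=> a; rewrite /contract /=.
- by move/Lpi.
- by move=> qa; apply/Lpi.
Qed.

End Quotient.

Section Residues.
Variables (A : comPzRingType) (I : set A) (hI : is_ideal I).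

Lemma multiplicative1 : Defs.multiplicative [set (1 : A)].
Proof. by split=> //= a b -> ->; rewrite mulr1. Qed.

(** [A / I] is the ring of fractions of [A / I] with denominators 1. *)
Definition quotient_map : {rmorphism A -> frac_ring hI multiplicative1} :=
  frac_map hI multiplicative1.

Lemma quotient_map_onto b : exists a, quotient_map a = b.
Proof.
rewrite -(qreprK b); case: (qrepr b) => a [s /= s1]; exists a.
by apply/qclsP; apply: (frac_eqv_eq hI multiplicative1) => /=; rewrite s1.
Qed.

Lemma quotient_map_ker a : quotient_map a = 0 <-> I a.
Proof.
rewrite -(rmorph0 quotient_map); split=> [/qclsP[_ /= ->]|Ia].
  by rewrite !mulr1 mul1r subr0.
by apply/qclsP; exists 1; rewrite //= !mulr1 mul1r subr0.
Qed.

Lemma quotient_finite_type : finite_type quotient_map.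
Proof.
exists [::] => S _ hS _ b; have [a <-] := quotient_map_onto b; exact: hS.
Qed.

End Residues.

Section GenericConstancy.
Variable A : comPzRingType.
Implicit Types (P Q q : Spec A).

(** [C] is a model of the residue field at P, so its dimension and its cotangent space are both
    zero. *)
Lemma regular_at_generic_point P (C : comPzRingType) (phi : {rmorphism A -> C}) :
  noetherian A -> fraction_map phi P P -> regular_local C.
Proof.
move=> nA hphi; have hP := prime_is_ideal P; have PP := @subset_refl _ (P : set A).
have base : rel_dim P P 0.
  split; first by exists P.
  move=> R [//|e] PR [S [RS nSR] /link_sub SP]; exfalso; apply: nSR.
  exact: subset_trans SP PR.
have bas : rel_basis P P (fun _ : 'I_0 => 0).
  split=> [i|y Py|a _ [m im] //].
    exact: ideal0 hP.
  exists 1, (fun=> 0); split; first exact: prime_neq1 (prime_setP P).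
  rewrite big_ord0 mul1r subr0; apply: addir => //; exact: is_idealX.
split.
- exact: (frac_local PP hphi).
- exact: (frac_noetherian hphi nA).
- by rewrite (frac_edim hP PP hphi bas) (frac_krull_dim hphi base).
Qed.

(** J-2 makes the regular locus of A / P open, and it contains the generic point; f lifts an
    equation of a basic open neighbourhood of that point. *)
Lemma generic_regular P : J2_ring A -> exists2 f, ~ prime_set P f &
  forall q, (P : set A) `<=` q -> ~ prime_set q f ->
    exists (C : comPzRingType) (phi : {rmorphism A -> C}),
      fraction_map phi P q /\ regular_local C.
Proof.
move=> [nA J2]; have hP := prime_is_ideal P.
pose pi := quotient_map hP.
have onto := quotient_map_onto (hI := hP); have ker := quotient_map_ker hP.
have [E locE] : open (@regular_locus (frac_ring hP (@multiplicative1 A))).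
  exact: J2 (quotient_finite_type hP).
have [P' P'E] := quotient_prime onto ker (@subset_refl _ (P : set A)).
have : regular_locus P'.
  have := quotient_fraction onto ker P'; rewrite P'E.
  exact: regular_at_generic_point.
rewrite locE /= => /existsNP[g /not_implyP[Eg nP'g]].
have [f fE] := onto g; exists f.
  by rewrite -P'E /contract /= fE.
move=> q Pq nqf; have [q' q'E] := quotient_prime onto ker Pq.
exists (localization q'), (loc_map q' \o pi : {rmorphism A -> localization q'}).
split; first by have := quotient_fraction onto ker q'; rewrite q'E.
rewrite -[regular_local _]/(regular_locus q') locE /= => /(_ g Eg).
by rewrite -fE; apply: contra_not nqf; rewrite -q'E.
Qed.

Lemma universally_catenary_catenary : universally_catenary A -> catenary A.
Proof.
by move=> [_ /(_ A idfun)]; apply; exists [::] => S _ hS _ a; exact: hS.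
Qed.

Definition embedding_defect (C : comPzRingType) : int :=
  (edim C)%:Z - (krull_dim C)%:Z.

(** The [y] generate P modulo P^2 at P; Nakayama's lemma supplies one denominator for finitely many
    generators of P, and hence for all of P. *)
Lemma generic_basis P e (y : 'I_e -> A) : noetherian A ->
  rel_basis [set 0] P y -> exists2 f, ~ prime_set P f & forall z,
    prime_set P z -> addi (lspan [seq y j | j <- enum 'I_e]) (idealX P 2) (f * z).
Proof.
move=> nA [_ spany _]; have hP := prime_is_ideal P.
have [s Ps] := noetherian_span nA hP.
have hJ := is_ideal_addi (is_ideal_mspan [seq y j | j <- enum 'I_e] (is_idealT A))
  (is_idealX P 2).
have [z|f nPf hf] := local_nakayama (s := s) (prime_setP P) hJ.
  rewrite -Ps => /spany[t [a [nPt]]]; rewrite addi0 => Xz; exists t => //.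
  apply: addir; first exact: is_ideal_mspan _ hP.
  by exists (\sum_i a i * y i) => //; apply/mspan_ord; exists a.
by exists f => // z; rewrite {1}Ps; exact: hf.
Qed.

(** Quantifying over every model [C] of A_q makes the result applicable to stalks without an
    isomorphism with [localization q]. *)
Lemma generic_embedding_defect P : excellent_ring A ->
  exists f (k : int), ~ prime_set P f /\
    forall q, (P : set A) `<=` q -> ~ prime_set q f ->
    forall (C : comPzRingType) (phi : {rmorphism A -> C}),
      fraction_map phi [set 0] q -> embedding_defect C = k.
Proof.
move=> [nA _ J2 /universally_catenary_catenary cA].
have hP := prime_is_ideal P; have h0 := is_ideal0 A.
have le0 q : [set 0] `<=` (q : set A) by move=> _ ->; exact: ideal0 (prime_is_ideal q).
have [f1 nPf1 regf] := generic_regular P J2.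
have [f2 nPf2 dimf] := generic_dim P nA cA.
have [e [y hy]] := rel_basis_exists nA (prime_setP P) h0.
have [f3 nPf3 basf] := generic_basis nA hy.
have [h hh] := rel_dim_exists nA h0 (le0 P).
(* The constant is the defect of A_P. At q both terms grow by the same number d, the dimension of
   the regular local ring (A / P)_q. *)
exists (f1 * (f2 * f3)), (e%:Z - h%:Z); split.
  by do 2 ?apply: prime_notM (prime_setP P) _ _.
move=> q Pq nqf C phi hphi; have hq := prime_is_ideal q.
have nqf1 : ~ prime_set q f1 by apply: contra_not nqf; rewrite mulrC; exact: idealM.
have nqf2 : ~ prime_set q f2.
  by apply: contra_not nqf => ?; rewrite mulrCA mulrC; exact: idealM.
have nqf3 : ~ prime_set q f3.
  by apply: contra_not nqf => ?; rewrite mulrA; exact: idealM.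
have [C' [phi' [hphi' [_ _ dimC']]]] := regf q Pq nqf1.
have [d hd] := rel_dim_exists nA hP Pq.
have [d' [x hx]] := rel_basis_exists nA (prime_setP q) hP.
move: dimC'; rewrite (frac_edim hP Pq hphi' hx) (frac_krull_dim hphi' hd) => dd.
subst d'; have lPq := rel_dim_start hd.
have hxy := rel_basis_cat nA Pq lPq hx hy nqf3 basf.
rewrite /embedding_defect (frac_edim h0 (le0 q) hphi hxy).
rewrite (frac_krull_dim hphi (dimf _ _ _ Pq nqf2 hh hd)).
by rewrite !PoszD; ring.
Qed.

End GenericConstancy.

(** * Stalks of a scheme *)

Section Germs.
Variables (X : topologicalType) (F : presheaf X) (x : X).

Definition germ (U : opens X) (Ux : opens_set U x) (s : F U) : stalk F x :=
  @qcls (stalk_preRing F x) (GermRep Ux s).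

Lemma germ_res (U V : opens X) (VU : V `<=` U) (Ux : opens_set U x)
  (Vx : opens_set V x) (s : F U) : germ Vx (res VU s) = germ Ux s.
Proof.
apply/qclsP; exists V, (fun y Vy => Vy), VU; split=> //=.
by rewrite res_res; exact: res_irr.
Qed.

Lemma germM (U : opens X) (Ux : opens_set U x) (s t : F U) :
  germ Ux (s * t) = germ Ux s * germ Ux t.
Proof.
rewrite -qclsM; apply/qclsP; have UI : U `<=` opensI U U by [].
exists U, (fun y Uy => Uy), UI; split=> //=.
by rewrite rmorphM [RHS]rmorphM !res_res; congr (_ * _); exact: res_irr.
Qed.

Lemma germB (U : opens X) (Ux : opens_set U x) (s t : F U) :
  germ Ux (s - t) = germ Ux s - germ Ux t.
Proof.
rewrite -qclsN -qclsD; apply/qclsP; have UI : U `<=` opensI U U by [].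
exists U, (fun y Uy => Uy), UI; split=> //=.
rewrite rmorphB rmorphD !rmorphN !res_res.
by congr (_ - _); exact: res_irr.
Qed.

Lemma germ1 (U : opens X) (Ux : opens_set U x) : germ Ux 1 = 1.
Proof.
apply/qclsP; exists U, (fun y Uy => Uy), (fun y Uy => I); split=> //=.
by rewrite !rmorph1.
Qed.

Lemma germ_eq0 (U : opens X) (Ux : opens_set U x) (s : F U) : germ Ux s = 0 ->
  exists (W : opens X) (WU : W `<=` U), opens_set W x /\ res WU s = 0.
Proof.
by move=> /qclsP[W [WU [WT [Wx /= e]]]]; exists W, WU; rewrite e rmorph0.
Qed.

Lemma germ_onto (c : stalk F x) :
  exists (U : opens X) (Ux : opens_set U x) (s : F U), c = germ Ux s.
Proof. by rewrite -(qreprK c); case: (qrepr c) => U Ux s; exists U, Ux, s. Qed.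

End Germs.

Section SpecSections.
Variable A : comPzRingType.

Lemma loc_map_frac (q : Spec A) (q1 : ~ prime_set q 1) a :
  loc_map q a = loc_frac a q1.
Proof.
by congr (qcls (P := frac_preRing _ _)); congr pair; exact: eq_exist.
Qed.

Lemma loc_frac_cancel (q : Spec A) a f (nqf : ~ prime_set q f) :
  loc_map q f * loc_frac a nqf = loc_map q a.
Proof.
rewrite -qclsM; apply/qclsP.
by apply: (frac_eqv_eq (is_ideal0 A) (prime_compl_multiplicative q)) => /=; ring.
Qed.

Lemma locally_fraction_const (V : opens (Spec A)) a :
  locally_fraction V (fun q => loc_map q a).
Proof.
move=> p Vp; exists V; split=> //; exists a, 1 => q _.
by exists (prime_neq1 (prime_setP q)); exact: loc_map_frac.
Qed.

Definition const_sec (V : opens (Spec A)) a : Spec_sheaf A V :=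
  @qcls (spec_sec_preRing V) (exist _ _ (locally_fraction_const (V := V) a)).

Lemma const_secB V a b : const_sec V (a - b) = const_sec V a - const_sec V b.
Proof.
by rewrite -qclsN -qclsD; apply/qclsP => p Vp /=; rewrite rmorphB.
Qed.

Lemma const_secM V a b : const_sec V (a * b) = const_sec V a * const_sec V b.
Proof. by rewrite -qclsM; apply/qclsP => p Vp /=; rewrite rmorphM. Qed.

Lemma const_sec1 V : const_sec V 1 = 1.
Proof. by apply/qclsP => p Vp /=; rewrite rmorph1. Qed.

Lemma res_const_sec (U V : opens (Spec A)) (VU : V `<=` U) a :
  res VU (const_sec U a) = const_sec V a.
Proof. by rewrite [LHS]spec_resE; apply/qclsP => p Vp. Qed.

Lemma const_sec_eq0 V a (q : Spec A) : opens_set V q -> const_sec V a = 0 ->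
  loc_map q a = 0.
Proof. by move=> Vq /qclsP /(_ q Vq). Qed.

Lemma basic_open_open f : open [set q : Spec A | ~ prime_set q f].
Proof.
exists [set f]; apply/seteqP; split=> q /= nqf h; first by apply: nqf; exact: h.
by apply: nqf => _ ->.
Qed.

Definition basic_open f : opens (Spec A) := MkOpens (basic_open_open f).

Lemma const_sec_unit f : exists s, const_sec (basic_open f) f * s = 1.
Proof.
(* The value 0 is taken only outside D(f), where sections are unconstrained. *)
pose s q := if pselect (~ prime_set q f) is left nqf then loc_frac 1 nqf else 0.
have sP q (nqf : ~ prime_set q f) : s q = loc_frac 1 nqf.
  rewrite /s; case: pselect => // nqf'; congr loc_frac; exact: Prop_irrelevance.
have hs : locally_fraction (basic_open f) s.
  move=> p nf; exists (basic_open f); split=> //.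
  by exists 1, f => q nqf; exists nqf; exact: sP.
exists (@qcls (spec_sec_preRing _) (exist _ s hs)).
rewrite -qclsM; apply/qclsP => p nf /=.
by rewrite sP loc_frac_cancel rmorph1.
Qed.

Lemma section_fraction V (s : Spec_sheaf A V) q : opens_set V q ->
  exists (W : opens (Spec A)) (WV : W `<=` V) a f,
    [/\ opens_set W q, ~ prime_set q f &
        const_sec W f * res WV s = const_sec W a].
Proof.
rewrite -(qreprK s); move: (qrepr s) => t Vq.
have [W [Wq WV [a [f h]]]] := svalP t q Vq.
exists W, WV, a, f; split=> //; first by have [] := h q Wq.
rewrite [X in _ * X](spec_resE WV t) -qclsM; apply/qclsP => p Wp /=.
by have [nf ->] := h p Wp; exact: loc_frac_cancel.
Qed.

End SpecSections.

Section Stalks.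
Variables (A : comPzRingType) (X : topologicalType) (F : presheaf X).
Variable j : Spec A -> X.

(** An element a of A is sent to the germ at [j q] of the section over the image of [j] that
    corresponds to the constant section a. The stalk then behaves as A_q because sections of
    [Spec_sheaf] are locally fractions. *)
Lemma stalk_fraction (q : Spec A) : open_immersion j (Spec_sheaf A) F ->
  exists phi : {rmorphism A -> stalk F (j q)}, fraction_map phi [set 0] q.
Proof.
move=> [jC jI [hj [psi [psi_bij psi_res]]]].
pose T := opensT (Spec A); pose im := opens_image hj.
have Tx : opens_set (im T) (j q) by exists q.
have psi_inj V : injective (psi V) := bij_inj (psi_bij V).
have psi_onto V t : exists s, psi V s = t.
  by have [g _ gK] := psi_bij V; exists (g t).
pose s a := sval (cid (psi_onto T (const_sec T a))).
have psi_s a : psi T (s a) = const_sec T a by rewrite /s; case: (cid _).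
have sB a b : s (a - b) = s a - s b.
  by apply: psi_inj; rewrite rmorphB !psi_s const_secB.
have sM a b : s (a * b) = s a * s b.
  by apply: psi_inj; rewrite rmorphM !psi_s const_secM.
have s1 : s 1 = 1 by apply: psi_inj; rewrite rmorph1 psi_s const_sec1.
pose phi a := germ Tx (s a).
have phiB : zmod_morphism phi by move=> a b; rewrite /phi sB germB.
have phiM : monoid_morphism phi.
  by split=> [|a b]; rewrite /phi ?s1 ?germ1 // sM germM.
pose phiR : {rmorphism A -> stalk F (j q)} := HB.pack phi
  (GRing.isZmodMorphism.Build _ _ phi phiB)
  (GRing.isMonoidMorphism.Build _ _ phi phiM).
have imS (U V : opens (Spec A)) (VU : V `<=` U) : im V `<=` im U.
  exact: opens_imageS.
have psi_resI (U V : opens (Spec A)) (VU : V `<=` U) (h : im V `<=` im U) t :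
    psi V (res h t) = res VU (psi U t).
  by rewrite -psi_res; congr (psi V _); exact: res_irr.
have VT (V : opens (Spec A)) : V `<=` T := @subsetT _ _.
have phi_germ (V : opens (Spec A)) (Vx : opens_set (im V) (j q)) a :
    phi a = germ Vx (res (imS _ _ (VT V)) (s a)) by rewrite germ_res.
have psi_resT V a : psi V (res (imS _ _ (VT V)) (s a)) = const_sec V a.
  by rewrite (psi_resI _ _ (VT V)) psi_s res_const_sec.
have imI V : opens_set V q -> opens_set (im V) (j q) by exists q.
have pull (U : opens X) : opens_set U (j q) ->
    exists2 V : opens (Spec A), opens_set V q & im V `<=` U.
  move=> Uq; exists (MkOpens (open_comp (fun x _ => jC x) (opensP U))) => //.
  by move=> _ [p Up <-].
have unit f : ~ prime_set q f -> exists b, phiR f * b = 1.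
  move=> nqf; have [u uE] := const_sec_unit f; have [t tE] := psi_onto _ u.
  have nqf' : opens_set (basic_open f) q by [].
  exists (germ (imI _ nqf') t); rewrite [phiR f](phi_germ _ (imI _ nqf')) -germM.
  rewrite -(germ1 F (imI _ nqf')); congr germ; apply: psi_inj.
  by rewrite rmorphM psi_resT tE uE rmorph1.
exists phiR; split=> [c|//|a].
  have [U [Ux [t ->]]] := germ_onto c.
  have [V Vq VU] := pull U Ux.
  have [W [WV [a [f [Wq nqf E]]]]] := section_fraction (psi V (res VU t)) Vq.
  exists a, f; split=> //; rewrite [phiR f](phi_germ W (imI W Wq)).
  rewrite [phiR a](phi_germ W (imI W Wq)) -(germ_res VU Ux (imI V Vq)).
  rewrite -(germ_res (imS _ _ WV) (imI V Vq) (imI W Wq)) -germM.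
  by congr germ; apply: psi_inj; rewrite rmorphM !psi_resT (psi_resI _ _ WV) E.
split=> [/germ_eq0[W [WT [Wx e]]]|[t nqt ta]].
  have [V Vq VW] := pull W Wx.
  have [_ _ locE] := localization_fraction q; apply/locE.
  apply: (const_sec_eq0 Vq); rewrite -psi_resT -[RHS](rmorph0 (psi V)).
  congr (psi V _); rewrite -(rmorph0 (res VW)) -e res_res; exact: res_irr.
have [b tb] := unit t nqt.
by rewrite -[LHS]mul1r -tb mulrAC -rmorphM ta rmorph0 mul0r.
Qed.

End Stalks.

(** * Constructibility *)

Section SpecTopology.
Variable A : comPzRingType.

(** A pair [(K, f)] stands for the locally closed set V(K) ∩ D(f). Noetherian induction on K: for K
    prime, E contains all or nothing of some V(K) ∩ D(f), and V(K + (f)) remains; otherwise V(K) is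
    empty or the union of some V(K + (a)) and V(K + (b)). *)
Lemma generically_constant_set (E : set (Spec A)) : noetherian A ->
  (forall P : Spec A, exists2 f, ~ prime_set P f &
     forall q : Spec A, (P : set A) `<=` q -> ~ prime_set q f -> E q <-> E P) ->
  exists s : seq (set A * A), forall q, E q <->
    exists c, [/\ c \in s, c.1 `<=` (q : set A) & ~ prime_set q c.2].
Proof.
move=> nA gen; suff h K : is_ideal K -> exists s : seq (set A * A), forall q,
    E q /\ K `<=` (q : set A) <->
    exists c, [/\ c \in s, c.1 `<=` (q : set A) & ~ prime_set q c.2].
  have [s hs] := h _ (is_ideal0 A); exists s => q; rewrite -hs.
  by split=> [Eq|[]//]; split=> // _ ->; exact: ideal0 (prime_is_ideal q).
move: K; apply: noetherian_ind => // K hK IH.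
have bigger c : ~ K c -> exists s : seq (set A * A), forall q,
    E q /\ adjoin K c `<=` (q : set A) <->
    exists c, [/\ c \in s, c.1 `<=` (q : set A) & ~ prime_set q c.2].
  move=> nKc; apply: IH; first exact: is_ideal_adjoin.
  by split; [exact: sub_adjoin|move=> /(_ c (adjoin_mem c hK))].
have adjoinE c (q : Spec A) : adjoin K c `<=` (q : set A) <->
    K `<=` (q : set A) /\ prime_set q c.
  split=> [h|[Kq qc]]; last exact: adjoin_sub (prime_is_ideal q) Kq qc.
  split; first exact: subset_trans (sub_adjoin c) h.
  exact: h (adjoin_mem c hK).
have [pK|npK] := pselect (is_prime K).
  pose P := MkSpec pK; have [f nPf hf] := gen P; have [s hs] := bigger f nPf.
  exists (if `[< E P >] then (K, f) :: s else s) => q.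
  have [qf|nqf] := pselect (prime_set q f).
    have -> : E q /\ K `<=` (q : set A) <-> E q /\ adjoin K f `<=` (q : set A).
      by rewrite adjoinE; tauto.
    rewrite hs; case: asboolP => // _; split=> -[c [cs cq nqc]].
      by exists c; rewrite inE cs orbT.
    by move: cs cq nqc; rewrite inE => /orP[/eqP-> //|cs]; exists c.
  split=> [[Eq Kq]|].
    rewrite asboolT; last exact/(hf q Kq nqf).
    by exists (K, f); rewrite mem_head.
  have nos : ~ exists c, [/\ c \in s, c.1 `<=` (q : set A) & ~ prime_set q c.2].
    by rewrite -hs adjoinE => -[_ [_]].
  case: asboolP => [EP|_ /nos//] [c [cs cq nqc]].
  move: cs; rewrite inE => /orP[/eqP cE|cs]; last by case: nos; exists c.
  by move: cq; rewrite cE => Kq; split=> //; exact/(hf q Kq nqf).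
have [K1|nK1] := pselect (K 1).
  exists [::] => q; split=> [[_ /(_ 1 K1)]|[c []//]].
  by move=> q1; case: (prime_neq1 (prime_setP q)).
have [a [b [Kab nKa nKb]]] := not_prime_factors hK nK1 npK.
have [s hs] := bigger a nKa; have [t ht] := bigger b nKb.
exists (s ++ t) => q; split=> [[Eq Kq]|[c [+ cq nqc]]].
  case: (prime_setP q) => _ _ /(_ a b (Kq _ Kab))[qc|qc].
  - have /hs[c [cs cq nqc]] : E q /\ adjoin K a `<=` (q : set A) by rewrite adjoinE.
    by exists c; rewrite mem_cat cs.
  - have /ht[c [cs cq nqc]] : E q /\ adjoin K b `<=` (q : set A) by rewrite adjoinE.
    by exists c; rewrite mem_cat cs orbT.
rewrite mem_cat => /orP[cs|cs].
- by have /hs : exists c, [/\ c \in s, c.1 `<=` (q : set A) & ~ prime_set q c.2];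
    [exists c|rewrite adjoinE => -[? []]].
- by have /ht : exists c, [/\ c \in t, c.1 `<=` (q : set A) & ~ prime_set q c.2];
    [exists c|rewrite adjoinE => -[? []]].
Qed.

End SpecTopology.

(** * Quasi-compactness and finite covers *)

Section CompactCovers.
Variable T : topologicalType.

Lemma cover_compactP (U : set T) : cover_compact U <->
  forall (I : choiceType) (D : set I) (f : I -> set T),
    (forall i, D i -> open (f i)) -> U `<=` cover D f ->
    exists2 s : seq I, forall i, i \in s -> D i & U `<=` cover [set` s] f.
Proof.
split=> h I D f Do Uf.
  have [D' D'D UD'] := h I D f Do Uf; exists (enum_fset D') => [i iD'|].
    by apply/set_mem/D'D.
  by move=> x /UD'[i /= iD' fx]; exists i.
have [s sD Us] := h I D f Do Uf; exists [fset i in s]%fset => [i|].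
  by rewrite !inE => /sD Di; exact/mem_set.
by move=> x /Us[i /= is_ fx]; exists i => //=; rewrite inE.
Qed.

Lemma cover_compact_bigcup (s : seq (set T)) (U : set T) :
  (forall V, V \in s -> cover_compact (U `&` V)) ->
  U `<=` \bigcup_(V in [set` s]) V -> cover_compact U.
Proof.
move=> sU Us; apply/cover_compactP => I D f Do Uf.
suff [t tD ht] : exists2 t : seq I, forall i, i \in t -> D i &
    forall V, V \in s -> U `&` V `<=` cover [set` t] f.
  by exists t => // x Ux; have [V /= Vs Vx] := Us x Ux; exact: (ht V).
elim: s {Us} sU => [|V s IH] sU; first by exists [::].
have [t tD ht] : exists2 t : seq I, forall i, i \in t -> D i &
    forall V, V \in s -> U `&` V `<=` cover [set` t] f.
  by apply: IH => W Ws; apply: sU; rewrite inE Ws orbT.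
have /cover_compactP/(_ I D f Do)[|r rD hr] := sU V (mem_head V s).
  by move=> x [/Uf].
exists (r ++ t) => [i|W]; first by rewrite mem_cat => /orP[/rD|/tD].
rewrite inE => /orP[/eqP->|Ws] x Ux.
- by have [i /= ir fx] := hr x Ux; exists i => //=; rewrite mem_cat ir.
- by have [i /= it fx] := ht W Ws x Ux; exists i => //=; rewrite mem_cat it orbT.
Qed.

Lemma compact_finite_cover (G : set T -> Prop) : cover_compact [set: T] ->
  (forall x, exists V, [/\ open V, V x & G V]) ->
  exists2 s : seq (set T), forall V, V \in s -> G V &
    [set: T] `<=` \bigcup_(V in [set` s]) V.
Proof.
move=> /cover_compactP cT hG; pose V x := sval (cid (hG x)).
have VP x : [/\ open (V x), V x x & G (V x)] by rewrite /V; case: (cid _).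
have [||s _ hs] := cT T [set: T] V.
- by move=> x _; have [] := VP x.
- by move=> x _; exists x => //; have [] := VP x.
exists (map V s) => [_ /mapP[x _ ->]|x _]; first by have [] := VP x.
by have [y /= ys Vyx] := hs x I; exists (V y) => //=; apply/mapP; exists y.
Qed.

(** Retrocompactness is automatic here, since intersections of two open sets are again open and so
    quasi-compact. *)
Lemma constructible_seq (s : seq (set T * set T)) :
  (forall U : set T, open U -> cover_compact U) ->
  (forall c, c \in s -> open c.1 /\ open c.2) ->
  constructible [set x | exists2 c, c \in s & c.1 x /\ ~ c.2 x].
Proof.
move=> allC sO; have retro (U : set T) : open U -> retrocompact U.
  by move=> Uo W Wo _; apply: allC; exact: openI.
pose c i := nth (set0, set0) s i.
exists (size s), (fun i => (c i).1), (fun i => (c i).2); split=> [i|].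
  have [o1 o2] : open (c i).1 /\ open (c i).2 by apply: sO; exact: mem_nth.
  by split=> //; exact: retro.
apply/seteqP; split=> x.
  move=> [_ /(nthP (set0, set0))[i isz <-] [h1 h2]].
  by exists (Ordinal isz).
by move=> [i _ [h1 h2]]; exists (c i) => //; exact: mem_nth.
Qed.

End CompactCovers.

(** The ideal [M] generated by all the equations of the complements of the [f i] has finitely many
    generators, which involve only finitely many i; a prime outside those [f i] contains [M], hence
    is outside every [f i]. *)
Lemma noetherian_spec_compact (A : comPzRingType) (U : set (Spec A)) :
  noetherian A -> open U -> cover_compact U.
Proof.
move=> nA _; apply/cover_compactP => I D f Do Uf.
have Eex i : {E | D i -> f i = ~` [set p : Spec A | E `<=` (p : set A)]}.
  apply: cid; have [Di|nDi] := pselect (D i); last by exists set0.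
  by have [E fE] := Do i Di; exists E.
pose E i := sval (Eex i).
have fE i : D i -> f i = ~` [set p : Spec A | E i `<=` (p : set A)].
  by rewrite /E; case: (Eex i).
pose L (t : seq I) := ideal_gen (\bigcup_(i in [set` t]) E i).
pose M := [set z | exists2 t, forall i, i \in t -> D i & L t z].
have Lmono t t' : {subset t <= t'} -> L t `<=` L t'.
  move=> tt'; apply: ideal_gen_sub; first exact: is_ideal_gen.
  by move=> z [i /= it Ez]; apply: sub_ideal_gen; exists i => //=; exact: tt'.
have hM : is_ideal M.
  split=> [|a b [t tD La] [t' t'D Lb]|a b [t tD Lb]].
  - by exists [::] => //; exact: ideal0 (is_ideal_gen _).
  - exists (t ++ t') => [i|]; first by rewrite mem_cat => /orP[/tD|/t'D].
    apply: (idealD (is_ideal_gen _)).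
    + by apply: Lmono La => i it; rewrite mem_cat it.
    + by apply: Lmono Lb => i it; rewrite mem_cat it orbT.
  - by exists t => //; exact: (idealM _ (is_ideal_gen _)).
have [s Ms] := noetherian_span nA hM.
have [t tD st] : exists2 t : seq I, forall i, i \in t -> D i &
    forall z, z \in s -> L t z.
  have : forall z, z \in s -> M z by move=> z zs; rewrite Ms; exact: mspan_mem.
  elim: s {Ms} => [|z r IH] rM; first by exists [::].
  have [t tD rt] : exists2 t : seq I, forall i, i \in t -> D i &
      forall z, z \in r -> L t z.
    by apply: IH => y yr; apply: rM; rewrite inE yr orbT.
  have [t' t'D Lz] := rM z (mem_head z r).
  exists (t ++ t') => [i|y]; first by rewrite mem_cat => /orP[/tD|/t'D].
  rewrite inE => /orP[/eqP->|/rt Ly].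
  - by apply: Lmono Lz => i it; rewrite mem_cat it orbT.
  - by apply: Lmono Ly => i it; rewrite mem_cat it.
exists t => // p /Uf[i Di fp]; apply: contrapT => ncov.
have tp k : k \in t -> E k `<=` (p : set A).
  move=> kt; apply: contrapT => nEp; apply: ncov.
  by exists k => //; rewrite fE; [exact: nEp|exact: tD].
move: fp; rewrite fE // => /=; apply => z Ez.
have : M z.
  exists [:: i] => [k|]; first by rewrite inE => /eqP->.
  by apply: sub_ideal_gen; exists i => //=; rewrite mem_head.
rewrite Ms; apply: mspan_sub; first exact: prime_is_ideal.
move=> y /st; apply: ideal_gen_sub; first exact: prime_is_ideal.
by move=> w [k /= kt]; exact: tp.
Qed.

Lemma image_compact (Y X : topologicalType) (j : Y -> X) (U : set Y) :
  continuous j -> cover_compact U -> cover_compact (j @` U).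
Proof.
move=> jC /cover_compactP cU; apply/cover_compactP => I D f Do jUf.
have [||s sD hs] := cU I D (fun i => j @^-1` (f i)).
- by move=> i Di; apply: open_comp (Do i Di) => x _; exact: jC.
- by move=> y Uy; have [i Di fi] := jUf (j y) (ex_intro2 _ _ y Uy erefl); exists i.
by exists s => // _ [y /hs[i /= is_ fi] <-]; exists i.
Qed.

Lemma locally_noetherian_open_compact (X : lrSpace) : locally_noetherian X ->
  cover_compact [set: X] -> forall U : set X, open U -> cover_compact U.
Proof.
move=> nX cX U Uo.
have [s sU cov] : exists2 s : seq (set X),
    forall V, V \in s -> cover_compact (U `&` V) &
    [set: X] `<=` \bigcup_(V in [set` s]) V.
  apply: compact_finite_cover => // x.
  have [A [j [nA [jC _ [hj _]] xj]]] := nX x.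
  exists (range j); split=> //; first exact/hj/openT.
  have -> : U `&` range j = j @` (j @^-1` U).
    apply/seteqP; split=> [y [Uy [p _ jp]]|_ [p Up <-]]; first by subst y; exists p.
    by split=> //; exists p.
  apply: image_compact => //.
  apply: noetherian_spec_compact => //.
  by apply: open_comp Uo => y _; exact: jC.
by apply: (cover_compact_bigcup sU) => x _; exact: cov.
Qed.

Theorem theoremC (X : lrSpace) (n : nat) :
  excellent_scheme X -> cover_compact [set: X] ->
  constructible [set x : X | embedding_codim x <= n%:Z].
Proof.
move=> [_ nX eX] cX; set E := [set x | _].
have allC := locally_noetherian_open_compact nX cX.
pose member (t : seq (set X * set X)) (x : X) :=
  exists2 c, c \in t & c.1 x /\ ~ c.2 x.
(* [G V] says that E ∩ V is a finite union of differences of open sets of X, a property stable under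
   finite unions of such V. *)
pose G (V : set X) := exists2 t : seq (set X * set X),
  forall c, c \in t -> open c.1 /\ open c.2 &
  forall x, member t x <-> E x /\ V x.
have [s sG cov] : exists2 s : seq (set X), forall V, V \in s -> G V &
    [set: X] `<=` \bigcup_(V in [set` s]) V.
  apply: compact_finite_cover => // x.
  have [A [j [eA jA xj]]] := eX x; have [nA _ _ _] := eA.
  have [jC jI [hj _]] := jA.
  exists (range j); split=> //; first exact/hj/openT.
  have [t ht] : exists t : seq (set A * A), forall q : Spec A, E (j q) <->
      exists c, [/\ c \in t, c.1 `<=` (q : set A) & ~ prime_set q c.2].
    apply: (generically_constant_set (E := j @^-1` E)) => // P.
    have [f [k [nPf hf]]] := generic_embedding_defect P eA.
    have defect (q : Spec A) : (P : set A) `<=` q -> ~ prime_set q f ->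
        embedding_codim (j q) = k.
      by move=> Pq nqf; have [phi] := stalk_fraction q jA; exact: hf.
    exists f => // q Pq nqf.
    by rewrite /E /preimage /= !defect.
  (* Both images are open in X because [j] is an open map. Since [j] is injective, the image of V(K)
     ∩ D(f) is the difference of [D f] and [N K]. *)
  pose D f := j @` [set q : Spec A | ~ prime_set q f].
  pose N K := j @` (~` [set q : Spec A | K `<=` (q : set A)]).
  exists [seq (D c.2, N c.1) | c <- t] => [_ /mapP[c _ ->]|y].
    split; apply: hj; first exact: basic_open_open.
    by exists c.1.
  split=> [[_ /mapP[c ct ->] [/= [q nqc qy] nNy]]|[Ey [q _ qy]]]; subst y.
    split; last by exists q.
    apply/ht; exists c; split=> //; apply: contrapT => ncq.
    by apply: nNy; exists q.
  have /ht[c [ct cq nqc]] := Ey; exists (D c.2, N c.1); first exact: map_f.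
  by split=> /=; [exists q|move=> [q' /= + /jI qE]; subst q'; apply].
have [t tO ht] : G (\bigcup_(V in [set` s]) V).
  elim: s sG {cov} => [|V s IH] sG.
    by exists [::] => // x; split=> [[]//|[_ []]].
  have [t tO ht] : G (\bigcup_(V in [set` s]) V).
    by apply: IH => W Ws; apply: sG; rewrite inE Ws orbT.
  have [r rO hr] := sG V (mem_head V s).
  exists (r ++ t) => [c|x]; first by rewrite mem_cat => /orP[/rO|/tO].
  split=> [[c + cx]|[Ex [W /=]]].
    rewrite mem_cat => /orP[cr|ct].
      have /hr[Ex Vx] : member r x by exists c.
      by split=> //; exists V => //=; rewrite mem_head.
    have /ht[Ex [W /= Ws Wx]] : member t x by exists c.
    by split=> //; exists W => //=; rewrite inE Ws orbT.
  rewrite inE => /orP[/eqP-> Vx|Ws Wx].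
    have /hr[c cr cx] : E x /\ V x by [].
    by exists c => //; rewrite mem_cat cr.
  have /ht[c ct cx] : E x /\ (\bigcup_(V in [set` s]) V) x by split=> //; exists W.
  by exists c => //; rewrite mem_cat ct orbT.
suff -> : E = [set x | member t x] by exact: constructible_seq.
apply/seteqP; split=> x /= => [Ex|/ht[]//].
by apply/ht; split=> //; exact: cov.
Qed.
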